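(* Let $\mu\preceq\nu$ be probability measures on $\mathbb{R}$ with finite first moments, $\mu$ without atoms, let $\mathbb{P}\in\mathcal{M}(\mu,\nu)$ be left-monotone, and let $(T_d,T_u)$ be a pair of maps representing $\mathbb{P}$. Let $B$ be a Brownian motion started from $B_0\sim\mu$. Then the stopping times $\tau_R$ and $\tau^{\mathbb{P}}$ are equal (almost surely). In particular, $\tau_R$ is a minimal stopping time and $(B_0,B_{\tau_R})\sim\mathbb{P}$.
   Context: $(X,Y)$ denotes the canonical process on $\mathbb{R}\times\mathbb{R}$. $\mu\preceq\nu$ (convex order) means $\int g\,d\mu\le\int g\,d\nu$ for every convex $g$. $\mathcal{M}(\mu,\nu)$ is the set of probability measures $\mathbb{P}$ on $\mathbb{R}\times\mathbb{R}$ with $X\sim_{\mathbb{P}}\mu$, $Y\sim_{\mathbb{P}}\nu$, $\mathbb{E}^{\mathbb{P}}[Y|X]=X$ $\mu$-a.s. $\mathbb{P}\in\mathcal{M}(\mu,\nu)$ is left-monotone if there is a Borel set $\Gamma\subset\mathbb{R}^2$ with $\mathbb{P}[(X,Y)\in\Gamma]=1$ such that for all $(x,y_0),(x,y_1),(x',y')\in\Gamma$ with $x<x'$, one has $y'\notin(y_0,y_1)$. Maps representing $\mathbb{P}$: a pair of functions $T_d,T_u:\mathbb{R}\to\mathbb{R}$ (which is known to exist when $\mu$ has no atoms and $\mathbb{P}$ is left-monotone) such that $T_d(x)\le x\le T_u(x)$ for all $x$; $\{x:T_d(x)=x\}=\{x:T_u(x)=x\}$; $$\mathbb{P}(dx,dy)=\mu(dx)\big[q(x)\delta_{T_u(x)}+(1-q(x))\delta_{T_d(x)}\big](dy),\quad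 q(x)=\frac{x-T_d(x)}{T_u(x)-T_d(x)}\mathbf{1}_{\{T_d(x)<T_u(x)\}};$$ $T_u$ is nondecreasing; and if $x<y$ then $T_d(y)\notin(T_d(x),T_u(x))$. Stopping times: $\tau^{\mathbb{P}}:=\inf\{t>0:B_t\notin[T_d(B_0),T_u(B_0)]\}$. Barrier: $R:=R_u\cup R_d$ with $$R_i:=\bigcup_{x\in\mathbb{R}}[T_i(x)-x,\infty)\times\{T_i(x)\},\quad i\in\{d,u\},$$ and $\tau_R:=\inf\{t\ge 0:(B_t-B_0,B_t)\in R\}$. A stopping time $\tau$ with $B_\tau\sim\nu$ is minimal if every stopping time $\sigma\le\tau$ with $B_\sigma\sim\nu$ satisfies $\sigma=\tau$ a.s. Stopping times are with respect to a filtration satisfying the usual conditions for which $B$ is a Brownian motion. *)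

(* Defs.v *)
From HB Require Import structures.
From mathcomp Require Import all_boot all_order all_algebra.
From mathcomp Require Import all_classical all_reals all_analysis.

Set Implicit Arguments.
Unset Strict Implicit.
Unset Printing Implicit Defensive.

Import Order.TTheory GRing.Theory Num.Theory.
Import numFieldNormedType.Exports.

Local Open Scope classical_set_scope.
Local Open Scope ring_scope.

Definition has_law d d' (T : measurableType d) (T' : measurableType d')
    (R : realType) (P : probability T R) (X : T -> T')
    (m : set T' -> \bar R) : Prop :=
  measurable_fun setT X /\
  forall A, measurable A -> pushforward P X A = m A.

Definition finite_first_moment (R : realType) (m : probability R R) : Prop :=
  m.-integrable setT (fun x => x%:E).

Definition atomless (R : realType) (m : probability R R) : Prop :=
  forall x : R, m [set x] = 0%E.

(* For measures with finite first moments the integrals below are well defined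
   in (-oo, +oo]: the negative part of a convex function is dominated by the
   modulus of an affine one. *)
Definition convex_order (R : realType) (mu nu : probability R R) : Prop :=
  forall g : R -> R, @convex_function R R^o setT g ->
    (\int[mu]_x (g x)%:E <= \int[nu]_x (g x)%:E)%E.

(* [Z] is a version of the conditional expectation of [Y] given the
   sub-sigma-algebra [G]. *)
Definition cond_expectation d (T : measurableType d) (R : realType)
    (P : probability T R) (G : set (set T)) (Y Z : T -> R) : Prop :=
  [/\ P.-integrable setT (EFin \o Y), P.-integrable setT (EFin \o Z),
      forall V : set R, measurable V -> G (Z @^-1` V) &
      forall A, G A -> (\int[P]_(w in A) (Z w)%:E = \int[P]_(w in A) (Y w)%:E)%E].

(* M(mu, nu): the martingale condition E[Y | X] = X a.s. says that X itself is
   a version of E[Y | sigma(X)]. *)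
Definition martingale_coupling (R : realType) (mu nu : probability R R)
    (Pi : probability (R * R)%type R) : Prop :=
  [/\ has_law Pi fst mu, has_law Pi snd nu &
      cond_expectation Pi (preimage_set_system setT fst measurable) snd fst].

Definition left_monotone (R : realType) (Pi : probability (R * R)%type R) :
    Prop :=
  exists Gam : set (R * R),
    [/\ measurable Gam, Pi Gam = 1%E &
        forall x y0 y1 x' y', Gam (x, y0) -> Gam (x, y1) -> Gam (x', y') ->
          x < x' -> ~ (y0 < y' < y1)].

Section representing_maps.
Variables (R : realType) (Td Tu : R -> R).

Definition up_weight (x : R) : R :=
  if Td x < Tu x then (x - Td x) / (Tu x - Td x) else 0.

Definition map_kernel (x : R) (V : set R) : \bar R :=
  ((up_weight x)%:E * \d_(Tu x) V + (1 - up_weight x)%:E * \d_(Td x) V)%E.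

(* Borel measurability of [Td] and [Tu], hence of the integrand below, is a
   consequence of the order conditions. *)
Definition represents (mu : probability R R)
    (Pi : probability (R * R)%type R) : Prop :=
  [/\ forall x, Td x <= x <= Tu x,
      [set x | Td x = x] = [set x | Tu x = x],
      forall C, measurable C ->
        Pi C = (\int[mu]_x map_kernel x (xsection C x))%E,
      {homo Tu : x y / x <= y} &
      forall x y, x < y -> ~ (Td x < Td y < Tu x)].

End representing_maps.

(* Time is [0, +oo): only the values at [t >= 0] of a process or of a
   filtration indexed by [R] are relevant. *)
Section stochastic_processes.
Context d (Omega : measurableType d) (R : realType) (P : probability Omega R).
Implicit Types (F : R -> set (set Omega)) (B : R -> Omega -> R).

Definition filtration F : Prop :=
  [/\ forall t : R, 0 <= t -> sigma_algebra setT (F t),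
      forall t : R, 0 <= t -> F t `<=` measurable &
      forall s t : R, 0 <= s -> s <= t -> F s `<=` F t].

(* [negligible] sets are arbitrary subsets of null sets, so the first condition
   includes the completeness of the probability space. *)
Definition usual_conditions F : Prop :=
  (forall N, P.-negligible N -> F 0 N) /\
  (forall t : R, 0 <= t -> F t = \bigcap_(s in [set s | t < s]) F s).

(* Increments are only constrained for [s < t]: the case [s = t] carries no
   information, and [normal_prob 0 0] is not the Dirac mass in the library. *)
Definition brownian_motion F (mu : probability R R) B : Prop :=
  [/\ has_law P (B 0) mu,
      forall t : R, 0 <= t -> forall V : set R, measurable V -> F t (B t @^-1` V),
      forall s t : R, 0 <= s -> s < t ->
        has_law P (B t \- B s) (normal_prob 0 (Num.sqrt (t - s))),
      forall s t : R, 0 <= s -> s < t ->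
        forall (A : set Omega) (V : set R), F s A -> measurable V ->
        P (A `&` (B t \- B s) @^-1` V) = (P A * P ((B t \- B s)%R @^-1` V))%E &
      {ae P, forall w, {within `[0, +oo[, continuous (fun t : R => B t w)}}].

Definition stopping_time F (tau : Omega -> \bar R) : Prop :=
  (forall w, (0 <= tau w)%E) /\
  (forall t : R, 0 <= t -> F t [set w | (tau w <= t%:E)%E]).

Definition stopped B (tau : Omega -> \bar R) (w : Omega) : R :=
  B (fine (tau w)) w.

(* [fine +oo = 0], so the law of the stopped process is only meaningful
   together with the almost sure finiteness of the stopping time. *)
Definition embeds B (nu : probability R R) (tau : Omega -> \bar R) : Prop :=
  {ae P, forall w, (tau w < +oo)%E} /\ has_law P (stopped B tau) nu.

Definition minimal_stopping_time F B (nu : probability R R)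
    (tau : Omega -> \bar R) : Prop :=
  [/\ stopping_time F tau, embeds B nu tau &
      forall sigma, stopping_time F sigma ->
        {ae P, forall w, (sigma w <= tau w)%E} -> embeds B nu sigma ->
        {ae P, forall w, sigma w = tau w}].

End stochastic_processes.

Section hitting_times.
Variables (R : realType) (Omega : Type).
Implicit Types (B : R -> Omega -> R) (Td Tu : R -> R).

Definition tau_exit Td Tu B (w : Omega) : \bar R :=
  ereal_inf [set t%:E | t in
    [set t : R | 0 < t /\ ~ (`[Td (B 0 w), Tu (B 0 w)]%classic (B t w))]].

Definition map_barrier (T : R -> R) : set (R * R) :=
  \bigcup_(x in setT) (`[T x - x, +oo[%classic `*` [set T x]).

Definition barrier Td Tu : set (R * R) := map_barrier Tu `|` map_barrier Td.

Definition tau_barrier (K : set (R * R)) B (w : Omega) : \bar R :=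
  ereal_inf [set t%:E | t in
    [set t : R | 0 <= t /\ K (B t w - B 0 w, B t w)]].

End hitting_times.

(* Main.v *)
Require Import Defs.
From HB Require Import structures.
From mathcomp Require Import all_boot all_order all_algebra.
From mathcomp Require Import all_classical all_reals all_analysis.
From mathcomp Require Import measurable_realfun ring lra.

Set Implicit Arguments.
Unset Strict Implicit.
Unset Printing Implicit Defensive.

Import Order.TTheory GRing.Theory Num.Theory.
Import numFieldNormedType.Exports.

Local Open Scope classical_set_scope.
Local Open Scope ring_scope.

(** Write x = B_0, a = Td x, b = Tu x, and let H be the first time at which B
is outside the open interval ]a, b[ ([hit_time]). Everything is a statement
about H.

- Geometry: tau_R = H on every continuous path ([barrier_time_gap]). The point
  (B_t - x, B_t) lies in the barrier exactly when B_t = T_i x' for some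
  x' >= x; the choice x' = x gives the endpoints a and b, and for x' > x the
  monotonicity of Tu and the left-monotonicity of Td keep T_i x' out of ]a, b[.

- H is the exit time tau_P from the closed interval, almost surely
  ([hit_time_exit_time]). Let the path go on after it has touched b, and stop
  it as soon as it touches a or exceeds b: this can only lower the stopped
  value at each deterministic time, but by optional stopping it does not change
  its mean. So the two stopped values agree, and a path that touched b without
  exceeding it at once would be constant for a while, which is impossible since
  B_s <> B_t almost surely for s < t. The same argument for - B treats a.

- Law ([coupling_law]). H is finite because the density of B_t - B_0 flattens
  out as t grows. Optional stopping with the weight 1 / (b - a) says that, given
  B_0, the path leaves through b with probability (x - a) / (b - a), which is the
  kernel that the maps prescribe.

- Minimality ([embedding_minimal]). Let sigma <= H embed the same law and let g
  be strictly convex and 1-Lipschitz. The chord of g over [a, b] dominates g, has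
  the same mean at B_sigma and at B_H by optional stopping, and agrees with g at
  B_H. As g has the same mean at B_sigma and at B_H too, the gap between chord
  and g vanishes at B_sigma, so B_sigma is a or b, that is H <= sigma.

The only probabilistic tool is thus optional stopping conditionally on B_0
([optional_stopping]), which is proved by discretising the stopping time: a
discrete stochastic integral is centred and bounded in L2 uniformly in the grid,
and this is enough to pass to the limit after a truncation. *)

(** * The centred normal law *)

Section normal.
Context (R : realType).
Implicit Types (s : R).
Local Notation leb := (@lebesgue_measure R).

(** The density is even; this gives centred increments without computing an
integral. *)
Lemma normal_prob_opp s (V : set R) : s != 0 -> measurable V ->
  normal_prob 0 s (-%R @^-1` V) = normal_prob 0 s V.
Proof.
move=> s0 mV; rewrite /normal_prob.
transitivity (\int[leb]_(x in -%R @^-1` V)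
    (((EFin \o normal_pdf 0 s : measurableTypeR R -> \bar R) \o
      (-%R : measurableTypeR R -> measurableTypeR R)) x))%E.
  apply: eq_integral => x _ /=; rewrite !normal_pdfE//= /normal_fun.
  by rewrite !subr0 sqrrN.
rewrite -(@ge0_integral_pushforward _ _ (measurableTypeR R) (measurableTypeR R))//=.
- apply: (@eq_measure_integral _ (measurableTypeR R) R V leb) => A mA _.
  exact: lebesgue_measureN.
- apply: measurable_funTS; apply/measurable_EFinP.
  exact: measurable_normal_pdf.
- by move=> x _; rewrite lee_fin normal_pdf_ge0.
Qed.

(** By uniqueness, the density that defines the measure is its Radon-Nikodym
derivative, for which the change of variables is known. *)
Lemma ge0_integral_normal_prob s (f : R -> \bar R) :
  measurable_fun setT f -> (forall x, 0 <= f x)%E ->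
  (\int[normal_prob 0 s]_x f x =
   \int[leb]_x (f x * (normal_pdf 0 s x)%:E))%E.
Proof.
move=> mf f0.
have dom := @normal_prob_dominates R 0 s.
rewrite -(Radon_Nikodym_SigmaFinite.change_of_variables dom f0)//.
apply: ae_eq_integral => //.
- apply: emeasurable_funM => //.
  by have /measurable_int := Radon_Nikodym_SigmaFinite.f_integrable dom; exact.
- apply: emeasurable_funM => //; apply/measurable_EFinP.
  exact: measurable_normal_pdf.
- apply: ae_eqe_mul2l; apply: integral_ae_eq => //.
  + exact: Radon_Nikodym_SigmaFinite.f_integrable.
  + by apply/measurable_EFinP; exact: measurable_normal_pdf.
  + by move=> E _ mE; rewrite -Radon_Nikodym_SigmaFinite.f_integral.
Qed.

(** Part of the Gaussian decay absorbs [x ^+ 2], and what remains is the density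
with standard deviation [2 * s]; only finiteness of the moment will matter. *)
Lemma normal_sqr_lty s : s != 0 ->
  (\int[normal_prob 0 s]_x (x ^+ 2)%:E < +oo)%E.
Proof.
move=> s0; rewrite ge0_integral_normal_prob//; last 2 first.
  by apply/measurable_EFinP; apply: exprn_measurable.
  by move=> x; rewrite lee_fin sqr_ge0.
pose c : R := (8 * s ^+ 2 / 3) * normal_peak s / normal_peak (2 * s).
have s20 : 2 * s != 0 by rewrite mulf_neq0.
apply: (@le_lt_trans _ _ (\int[leb]_x (c%:E * (normal_pdf 0 (2 * s) x)%:E))%E).
  apply: ge0_le_integral => //.
  - by move=> x _; rewrite mule_ge0// lee_fin ?sqr_ge0// normal_pdf_ge0.
  - apply/measurable_EFinP; apply: measurable_funM; first exact: exprn_measurable.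
    exact: measurable_normal_pdf.
  - apply/measurable_EFinP; apply: measurable_funM => //.
    exact: measurable_normal_pdf.
  - move=> x _; rewrite -!EFinM lee_fin !normal_pdfE//= /c.
    rewrite [leRHS](_ : _ = normal_peak s *
      ((8 * s ^+ 2 / 3) * normal_fun 0 (2 * s) x)); last first.
      have := @normal_peak_gt0 R (2 * s) s20 => /lt0r_neq0 p0; field.
      by rewrite p0.
    rewrite mulrCA ler_wpM2l ?normal_peak_ge0//.
    rewrite /normal_fun !subr0.
    have s2 : 0 < s ^+ 2 by rewrite exprn_even_gt0.
    rewrite [X in _ * X <= _](_ : _ = expR (- x ^+ 2 / ((2 * s) ^+ 2 *+ 2)) *
       expR (- (3 * x ^+ 2 / (8 * s ^+ 2)))); last first.
      by rewrite -expRD; congr expR; field.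
    rewrite mulrCA [leRHS]mulrC ler_wpM2l ?expR_ge0//.
    rewrite expRN ler_pdivrMr ?expR_gt0//.
    (* 3 / (8 s^2) = 1 / (2 s^2) - 1 / (2 (2 s)^2), and u <= exp u *)
    set u := 3 * _ / _.
    have -> : x ^+ 2 = (8 * s ^+ 2 / 3) * u by rewrite /u; field.
    rewrite ler_wpM2l//; first by rewrite divr_ge0// mulr_ge0// ltW.
    by apply: le_trans (expR_ge1Dx u); rewrite lerDr.
rewrite ge0_integralZl//.
- by rewrite integral_normal_pdf mule1 ltry.
- by apply/measurable_EFinP; exact: measurable_normal_pdf.
- by move=> x _; rewrite lee_fin normal_pdf_ge0.
- by rewrite lee_fin /c divr_ge0 ?normal_peak_ge0// mulr_ge0 ?normal_peak_ge0//
   divr_ge0// mulr_ge0// sqr_ge0.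
Qed.

(** The density is at most its peak, of order 1 / [s]: a Gaussian with large
variance is unlikely to be in a given bounded set. *)
Lemma normal_prob_ball s (k : R) : s != 0 -> 0 <= k ->
  (normal_prob 0 s [set x : R | (`|x| <= k)%R] <= (2 * k * normal_peak s)%:E)%E.
Proof.
move=> s0 k0; rewrite /normal_prob.
have -> : [set x : R | `|x| <= k] = `[- k, k]%classic.
  by apply/seteqP; split=> x /=; rewrite in_itv/= ler_norml.
have mpdf : measurable_fun `[- k, k]%classic (EFin \o normal_pdf 0 s).
  by apply: measurable_funTS; apply/measurable_EFinP; exact: measurable_normal_pdf.
have /le_trans -> // : (\int[leb]_(x in `[(- k)%R, k]) (normal_pdf 0 s x)%:E <=
    \int[leb]_(x in `[(- k)%R, k]) (normal_peak s)%:E)%E.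
  apply: ge0_le_integral => //.
  - by move=> x _; rewrite lee_fin normal_pdf_ge0.
  - by move=> x _; rewrite lee_fin normal_pdf_ub.
rewrite integral_cst//= lebesgue_measure_itv/= lte_fin.
case: ifPn => _; last by rewrite mule0 lee_fin !mulr_ge0 ?normal_peak_ge0.
by rewrite -EFinB -EFinM lee_fin; have := normal_peak_ge0 s; nra.
Qed.

Lemma normal_prob_set1 s (c : R) : normal_prob 0 s [set c] = 0%E.
Proof.
have /null_content_dominatesP := @normal_prob_dominates R 0 s; apply => //.
exact: lebesgue_measure_set1.
Qed.

End normal.

(** * Independent pairs *)

Section independence.
Context d (T : measurableType d) (R : realType) (P : probability T R).

Definition indep_var (X W : T -> R) := forall A V : set R, measurable A ->
  measurable V -> P (X @^-1` A `&` W @^-1` V) = (P (X @^-1` A) * P (W @^-1` V))%E.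

Section pair.
Variables X W : T -> R.
Hypotheses (mX : measurable_fun setT X) (mW : measurable_fun setT W).
Hypothesis XW : indep_var X W.

Let Xm : {mfun T >-> R} := mfun_Sub (mem_set mX).
Let Wm : {mfun T >-> R} := mfun_Sub (mem_set mW).
Let mXW : measurable_fun setT (fun w => (X w, W w)).
Proof. exact: measurable_fun_pair. Qed.
Let XWm : {mfun T >-> (R * R)%type} := mfun_Sub (mem_set mXW).

Let law_pair (C : set (R * R)) : measurable C ->
  (distribution P Xm \x distribution P Wm)%E C = distribution P XWm C.
Proof.
move=> mC.
apply: (@product_measure_unique _ _ R R R _ _ (distribution P XWm)) => //.
Qed.

(** The pair has the product law, since a measure on a product is determined by
its values on rectangles; Tonelli's theorem does the rest. *)
Lemma indep_integral_ge0 (f : R * R -> \bar R) :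
  measurable_fun setT f -> (forall z, 0 <= f z)%E ->
  (\int[P]_w f (X w, W w) = \int[P]_w \int[P]_v f (X w, W v))%E.
Proof.
move=> mf f0.
rewrite -[LHS](@ge0_integral_pushforward _ _ _ _ R _ mXW P setT f)//.
transitivity (\int[distribution P Xm \x distribution P Wm]_z f z)%E.
  by apply: eq_measure_integral => C mC _; rewrite /= law_pair.
rewrite fubini_tonelli1//.
rewrite [LHS](@ge0_integral_pushforward _ _ _ _ R _ mX P setT)//=.
- apply: eq_integral => w _; rewrite /fubini_F/=.
  rewrite [LHS](@ge0_integral_pushforward _ _ _ _ R _ mW P setT)//=.
  by apply: measurableT_comp => //; exact: measurable_fun_pair.
- by apply: measurable_fun_fubini_tonelli_F.
- by move=> x _; apply: integral_ge0.
Qed.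

End pair.

Lemma indep_integralM_ge0 (X W : T -> R) :
  measurable_fun setT X -> measurable_fun setT W -> indep_var X W ->
  (forall w, 0 <= X w) -> (forall w, 0 <= W w) ->
  (\int[P]_w (X w * W w)%:E = (\int[P]_w (X w)%:E) * (\int[P]_w (W w)%:E))%E.
Proof.
move=> mX mW XW X0 W0.
transitivity (\int[P]_w (`|X w| * `|W w|)%:E)%E.
  by apply: eq_integral => w _; rewrite !ger0_norm.
rewrite (@indep_integral_ge0 X W mX mW XW (fun z => (`|z.1| * `|z.2|)%:E))/=.
- transitivity (\int[P]_w ((X w)%:E * \int[P]_w (W w)%:E))%E.
    apply: eq_integral => w _; rewrite -ge0_integralZl//.
    + by apply: eq_integral => v _; rewrite -EFinM !ger0_norm.
    + exact/measurable_EFinP.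
    + by move=> v _; rewrite lee_fin.
    + by rewrite lee_fin.
  rewrite ge0_integralZr//.
  + exact/measurable_EFinP.
  + by move=> v _; rewrite lee_fin.
  + by apply: integral_ge0 => v _; rewrite lee_fin.
- by apply/measurable_EFinP; apply: measurable_funM; apply: measurableT_comp.
- by move=> z; rewrite lee_fin mulr_ge0.
Qed.

Lemma indep_var_comp (X W : T -> R) (f g : R -> R) :
  measurable_fun setT f -> measurable_fun setT g ->
  indep_var X W -> indep_var (f \o X) (g \o W).
Proof.
move=> mf mg XW A V mA mV; apply: (XW (f @^-1` A) (g @^-1` V)).
- by rewrite -[X in measurable X]setTI; exact: mf.
- by rewrite -[X in measurable X]setTI; exact: mg.
Qed.

Lemma indep_integrableM (X W : T -> R) :
  P.-integrable setT (EFin \o X) -> P.-integrable setT (EFin \o W) ->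
  indep_var X W -> P.-integrable setT (EFin \o (fun w => X w * W w)).
Proof.
move=> iX iW XW.
have mX : measurable_fun setT X by apply/measurable_EFinP; exact: measurable_int iX.
have mW : measurable_fun setT W by apply/measurable_EFinP; exact: measurable_int iW.
apply/integrableP; split; first by apply/measurable_EFinP; exact: measurable_funM.
have -> : (\int[P]_w `|(EFin \o (fun w => X w * W w)%R) w| =
    \int[P]_w ((Num.norm \o X) w * (Num.norm \o W) w)%:E)%E.
  by apply: eq_integral => w _ /=; rewrite normrM.
have mX' : measurable_fun setT (Num.norm \o X) by exact: measurableT_comp.
have mW' : measurable_fun setT (Num.norm \o W) by exact: measurableT_comp.
have XW' : indep_var (Num.norm \o X) (Num.norm \o W).
  by apply: indep_var_comp => //; exact: normr_measurable.
rewrite (indep_integralM_ge0 mX' mW' XW'); [|by move=> w /=..].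
move/integrableP : iX => [_ iX]; move/integrableP : iW => [_ iW].
have g0 (Z : T -> R) : (0 <= \int[P]_w ((Num.norm \o Z) w)%:E)%E.
  by apply: integral_ge0 => w _; rewrite lee_fin /=.
by apply: lte_mul_pinfty => //; rewrite ge0_fin_numE.
Qed.

(** The case of nonnegative variables, applied to the positive and negative
parts. *)
Lemma indep_integralM (X W : T -> R) :
  P.-integrable setT (EFin \o X) -> P.-integrable setT (EFin \o W) ->
  indep_var X W ->
  \int[P]_w (X w * W w) = (\int[P]_w X w) * (\int[P]_w W w).
Proof.
move=> iX iW XW.
have pos Z : P.-integrable setT (EFin \o Z) ->
    P.-integrable setT (EFin \o (Num.max^~ 0 \o Z)) /\
    P.-integrable setT (EFin \o (Num.max^~ 0 \o -%R \o Z)).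
  move=> iZ; split; first exact: integrable_funrpos.
  exact: integrable_funrneg.
have mp : measurable_fun [set: R] (Num.max^~ 0 : R -> R).
  by apply: measurable_maxr => //; exact: measurable_id.
have mn : measurable_fun [set: R] (Num.max^~ 0 \o -%R : R -> R).
  by apply: measurableT_comp.
have key (f g : R -> R) : measurable_fun [set: R] f -> measurable_fun [set: R] g ->
    (forall x, 0 <= f x) -> (forall x, 0 <= g x) ->
    P.-integrable setT (EFin \o (f \o X)) ->
    P.-integrable setT (EFin \o (g \o W)) ->
    P.-integrable setT (EFin \o (fun w => f (X w) * g (W w))) /\
    \int[P]_w (f (X w) * g (W w)) = (\int[P]_w f (X w)) * (\int[P]_w g (W w)).
  move=> mf mg f0 g0 iX' iW'.
  have XW' := indep_var_comp mf mg XW.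
  split; first exact: (indep_integrableM iX' iW').
  rewrite /Rintegral -fineM ?integrable_fin_num//; congr fine.
  apply: (@indep_integralM_ge0 (f \o X) (g \o W)) => //=.
  - by apply/measurable_EFinP; exact: measurable_int iX'.
  - by apply/measurable_EFinP; exact: measurable_int iW'.
have p0 : forall x : R, 0 <= Num.max x 0 by move=> x; rewrite le_max lexx orbT.
have n0 : forall x : R, 0 <= (Num.max^~ 0 \o -%R) x by move=> x; exact: p0.
have E (x : R) : x = Num.max x 0 - (Num.max^~ 0 \o -%R) x.
  by rewrite /= /Num.max; case: ifPn; case: ifPn; lra.
have [Xp Xn] := pos _ iX; have [Wp Wn] := pos _ iW.
have [pp1 pp2] := key _ _ mp mp p0 p0 Xp Wp.
have [pn1 pn2] := key _ _ mp mn p0 n0 Xp Wn.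
have [np1 np2] := key _ _ mn mp n0 p0 Xn Wp.
have [nn1 nn2] := key _ _ mn mn n0 n0 Xn Wn.
have dec Z : P.-integrable setT (EFin \o Z) -> \int[P]_w Z w =
    (\int[P]_w Num.max (Z w) 0) - (\int[P]_w (Num.max^~ 0 \o -%R) (Z w)).
  move=> /pos[Z1 Z2]; rewrite -RintegralB//.
  by apply: eq_Rintegral => w _; exact: E.
rewrite (dec X iX) (dec W iW) mulrBl !mulrBr -pp2 -pn2 -np2 -nn2.
rewrite -!RintegralB//=; last 2 first.
  by have := integrableB measurableT pp1 pn1.
  by have := integrableB measurableT np1 nn1.
by apply: eq_Rintegral => w _ /=; rewrite [X in X * _]E [X in _ * X]E/=; ring.
Qed.

End independence.

(** * Brownian increments *)

Section brownian.
Context d (Omega : measurableType d) (R : realType) (P : probability Omega R).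
Variables (mu : probability R R) (F : R -> set (set Omega)) (B : R -> Omega -> R).
Hypotheses (F_filtration : filtration F) (F_usual : usual_conditions P F).
Hypothesis B_brownian : brownian_motion P F mu B.
Implicit Types s t : R.

(** Measurability is taken on [Omega] with the sigma-algebra [F t], so that the
closure properties of measurable functions apply to adapted variables. *)
Definition adapted_at (t : R) d' (T' : measurableType d') (X : Omega -> T') :=
  measurable_fun [set: g_sigma_algebraType (F t)] X.

Lemma F_measurable t (A : set Omega) : 0 <= t ->
  F t A <-> measurable (A : set (g_sigma_algebraType (F t))).
Proof.
move=> t0; have [/(_ t t0) sF _ _] := F_filtration; split.
  by move=> FA; exact: sub_sigma_algebra.
by rewrite /measurable/= sigma_algebra_id.
Qed.

Lemma adapted_atP t d' (T' : measurableType d') (X : Omega -> T') : 0 <= t ->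
  adapted_at t X <-> (forall V : set T', measurable V -> F t (X @^-1` V)).
Proof.
move=> t0; split=> [mX V mV|mX].
  apply/F_measurable => //; rewrite -[X in measurable X]setTI; exact: mX.
by move=> _ V mV; rewrite setTI; apply/F_measurable => //; exact: mX.
Qed.

Lemma adapted_at_le s t d' (T' : measurableType d') (X : Omega -> T') :
  0 <= s -> s <= t -> adapted_at s X -> adapted_at t X.
Proof.
move=> s0 st /adapted_atP aX; apply/adapted_atP; first exact: le_trans st.
by move=> V mV; have [_ _] := F_filtration; apply; [exact: s0| |exact: aX].
Qed.

Lemma adapted_at_measurable t d' (T' : measurableType d') (X : Omega -> T') :
  0 <= t -> adapted_at t X -> measurable_fun setT X.
Proof.
move=> t0 /adapted_atP aX _ V mV; rewrite setTI.
by have [_ FM _] := F_filtration; apply: (FM t) => //; exact: aX.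
Qed.

Lemma B_adapted t : 0 <= t -> adapted_at t (B t).
Proof.
by move=> t0; apply/adapted_atP => // V mV; have [_ h _ _ _] := B_brownian; exact: h.
Qed.

Lemma measurable_B t : 0 <= t -> measurable_fun setT (B t).
Proof. by move=> t0; apply: (adapted_at_measurable t0); exact: B_adapted. Qed.

Definition incr s t w : R := B t w - B s w.

Lemma incr_law s t : 0 <= s -> s < t ->
  has_law P (incr s t) (normal_prob 0 (Num.sqrt (t - s))).
Proof. by move=> s0 st; have [_ _ h _ _] := B_brownian; exact: h. Qed.

Lemma sqrt_neq0 (s t : R) : s < t -> Num.sqrt (t - s) != 0.
Proof. by move=> st; rewrite gt_eqF// sqrtr_gt0 subr_gt0. Qed.

Lemma measurable_incr s t : 0 <= s -> 0 <= t -> measurable_fun setT (incr s t).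
Proof. by move=> s0 t0; apply: measurable_funB; exact: measurable_B. Qed.

Lemma incr_indep s t X : 0 <= s -> s < t -> adapted_at s (X : Omega -> R) ->
  indep_var P X (incr s t).
Proof.
move=> s0 st /adapted_atP aX A V mA mV.
by have [_ _ _ h _] := B_brownian; apply: h => //; exact: aX.
Qed.

Lemma integral_incr_ge0 s t (f : R -> \bar R) : 0 <= s -> s < t ->
  measurable_fun setT f -> (forall x, 0 <= f x)%E ->
  (\int[P]_w f (incr s t w) =
   \int[normal_prob 0 (Num.sqrt (t - s))]_x f x)%E.
Proof.
move=> s0 st mf f0; have [mW hW] := incr_law s0 st.
rewrite -[LHS](@ge0_integral_pushforward _ _ _ (measurableTypeR R) R _ mW P setT f)//.
by apply: eq_measure_integral => V mV _; exact: hW.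
Qed.

Lemma sqr_integrable (X : Omega -> R) : measurable_fun setT X ->
  P.-integrable setT (EFin \o (fun w => X w ^+ 2)) ->
  P.-integrable setT (EFin \o X).
Proof.
move=> mX iX; apply: (@le_integrable _ _ _ P setT measurableT _
    (EFin \o (fun w => 1 + X w ^+ 2))).
- exact/measurable_EFinP.
- move=> w _ /=; rewrite lee_fin [leRHS]ger0_norm; last first.
    by rewrite addr_ge0// sqr_ge0.
  by rewrite -[X w ^+ 2]real_normK ?num_real//; set u := `|X w|; nra.
- have i1 : P.-integrable setT (EFin \o (cst 1 : Omega -> R)).
    exact: finite_measure_integrable_cst.
  by have := integrableD measurableT i1 iX.
Qed.

Lemma incr_sqr_integrable s t : 0 <= s -> s < t ->
  P.-integrable setT (EFin \o (fun w => incr s t w ^+ 2)).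
Proof.
move=> s0 st; apply/integrableP; split.
  apply/measurable_EFinP/measurable_funX; apply: measurable_incr => //.
  by apply: le_trans (ltW st).
have msq : measurable_fun [set: R] (fun x : R => (x ^+ 2)%:E).
  by apply/measurable_EFinP; exact: exprn_measurable.
have sq0 (x : R) : (0 <= (x ^+ 2)%:E)%E by rewrite lee_fin sqr_ge0.
have := normal_sqr_lty (sqrt_neq0 st); rewrite -(integral_incr_ge0 s0 st msq sq0).
apply: le_lt_trans; rewrite le_eqVlt; apply/orP; left; apply/eqP.
by apply: eq_integral => w _ /=; rewrite ger0_norm ?sqr_ge0.
Qed.

Lemma incr_integrable s t : 0 <= s -> s < t ->
  P.-integrable setT (EFin \o incr s t).
Proof.
move=> s0 st; apply: sqr_integrable; last exact: incr_sqr_integrable.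
by apply: measurable_incr => //; exact: le_trans (ltW st).
Qed.

(** An increment and its opposite have the same law. *)
Lemma incr_mean0 s t : 0 <= s -> s < t -> \int[P]_w incr s t w = 0.
Proof.
move=> s0 st; have iW := incr_integrable s0 st.
have [mW hW] := incr_law s0 st.
have mNW : measurable_fun setT (-%R \o incr s t) by exact: measurableT_comp.
suff : \int[P]_w incr s t w = \int[P]_w (- incr s t w).
  rewrite -[X in _ = X]/(\int[P]_w ((-%R \o incr s t) w)).
  have -> : \int[P]_w ((-%R \o incr s t) w) = - \int[P]_w incr s t w.
    rewrite -mulN1r -RintegralZl//; apply: eq_Rintegral => w _ /=.
    by rewrite mulN1r.
  lra.
rewrite /Rintegral; congr fine.
rewrite -[LHS](@integral_pushforward _ _ _ _ R _ mW P setT EFin)//.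
rewrite -[RHS](@integral_pushforward _ _ _ _ R _ mNW P setT EFin)//; last first.
  by have := integrableN iW.
apply: (@eq_measure_integral _ _ R) => V mV _.
have mNV : measurable (-%R @^-1` V : set R).
  by rewrite -[X in measurable X]setTI; exact: oppr_measurable.
transitivity (pushforward P (incr s t) (-%R @^-1` V)); last by [].
rewrite !hW// normal_prob_opp//; [exact: hW|exact: sqrt_neq0].
Qed.

(** The normal law has no atom; in this form it forbids flat stretches of the
path. *)
Lemma incr_neq0 s t : 0 <= s -> s < t -> {ae P, forall w, B s w != B t w}.
Proof.
move=> s0 st; have [mW hW] := incr_law s0 st.
exists [set w | incr s t w = 0]; split.
- rewrite -[X in measurable X]setTI.
  exact: (mW measurableT [set 0] (measurable_set1 0)).
- have := hW [set 0] (measurable_set1 0); rewrite normal_prob_set1.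
  by rewrite /pushforward.
- by move=> w /= /negP; rewrite negbK => /eqP E; rewrite /incr E subrr.
Qed.

End brownian.

(** * Discrete stochastic integrals *)

Section martingale_transform.
Context d (Omega : measurableType d) (R : realType) (P : probability Omega R).
Variables (mu : probability R R) (F : R -> set (set Omega)) (B : R -> Omega -> R).
Hypotheses (F_filtration : filtration F).
Hypothesis B_brownian : brownian_motion P F mu B.
Variable t_ : nat -> R.
Hypotheses (t0 : 0 <= t_ 0%N) (t_incr : forall k, t_ k < t_ k.+1).

(** The discrete stochastic integral of [Z] against [B]. *)
Definition transform (Z : nat -> Omega -> R) m w : R :=
  \sum_(k < m) Z k w * incr B (t_ k) (t_ k.+1) w.

Let t_ge0 k : 0 <= t_ k.
Proof. by elim: k => // k /le_trans; apply; exact: ltW. Qed.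

Lemma bounded_integrableM (X Y : Omega -> R) C : measurable_fun setT X ->
  (forall w, `|X w| <= C) -> P.-integrable setT (EFin \o Y) ->
  P.-integrable setT (EFin \o (fun w => X w * Y w)).
Proof.
move=> mX XC iY.
have mY : measurable_fun setT Y by apply/measurable_EFinP; exact: measurable_int iY.
apply: (@le_integrable _ _ _ P setT measurableT _ (fun w => (`|C|%:E * (EFin \o Y) w)%E)).
- by apply/measurable_EFinP; exact: measurable_funM.
- move=> w _ /=; rewrite lee_fin !normrM; apply: ler_wpM2r => //.
  by rewrite normr_id; apply: le_trans (XC w) _; exact: ler_norm.
- exact: integrableZl.
Qed.

Section bounded.
Variables (Z : nat -> Omega -> R) (C : R).
Hypotheses (aZ : forall k, adapted_at F (t_ k) (Z k)).
Hypothesis ZC : forall k w, `|Z k w| <= C.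

Let mZ k : measurable_fun setT (Z k).
Proof. exact: (adapted_at_measurable F_filtration (t_ge0 k)). Qed.

Lemma transform_adapted m : adapted_at F (t_ m) (transform Z m).
Proof.
elim: m => [|m IH].
  rewrite /transform (_ : (fun w => _) = cst 0); first exact: measurable_cst.
  by apply/funext => w; rewrite big_ord0.
have -> : transform Z m.+1 = (fun w => transform Z m w +
    Z m w * (B (t_ m.+1) w - B (t_ m) w)).
  by apply/funext => w; rewrite /transform big_ord_recr.
have up d' (T' : measurableType d') (X : Omega -> T') : adapted_at F (t_ m) X ->
    adapted_at F (t_ m.+1) X.
  by apply: (adapted_at_le F_filtration) => //; exact: ltW.
apply: measurable_funD; first exact: up.
apply: measurable_funM; first exact: up.
apply: measurable_funB; first exact: (B_adapted F_filtration B_brownian).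
by apply: up; exact: (B_adapted F_filtration B_brownian).
Qed.

(** The variable multiplying the last increment is known at the time where that
increment starts, hence independent of it. As the increment is centred, the
cross terms vanish. *)
Lemma transform_moments m :
  [/\ P.-integrable setT (EFin \o (fun w => transform Z m w ^+ 2)),
      \int[P]_w transform Z m w = 0 &
      \int[P]_w (transform Z m w ^+ 2) =
      \sum_(k < m) \int[P]_w (Z k w ^+ 2 * incr B (t_ k) (t_ k.+1) w ^+ 2)].
Proof.
elim: m => [|m [IH1 IH2 IH3]].
  have E : transform Z 0 = cst 0 by apply/funext => w; rewrite /transform big_ord0.
  rewrite E big_ord0 /=; split.
  - apply: (eq_integrable _ (cst 0%E)) => //= [w _|]; rewrite ?expr0n//=.
    exact: integrable0.
  - by rewrite /= Rintegral_cst// mul0r.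
  - by under eq_Rintegral do rewrite /= expr0n/=; rewrite Rintegral_cst// mul0r.
pose W := incr B (t_ m) (t_ m.+1).
pose S := transform Z m.
have aS : adapted_at F (t_ m) S by exact: transform_adapted.
have mS : measurable_fun setT S by exact: (adapted_at_measurable F_filtration (t_ge0 m)).
have iS : P.-integrable setT (EFin \o S) by exact: sqr_integrable.
have iW : P.-integrable setT (EFin \o W) by exact: (incr_integrable F_filtration B_brownian).
have iW2 : P.-integrable setT (EFin \o (fun w => W w ^+ 2)).
  exact: (incr_sqr_integrable F_filtration B_brownian).
have E : transform Z m.+1 = (fun w => S w + Z m w * W w).
  by apply/funext => w; rewrite /S /W /transform big_ord_recr.
have i0 (X : Omega -> R) : adapted_at F (t_ m) X -> P.-integrable setT (EFin \o X) ->
    P.-integrable setT (EFin \o (fun w => X w * W w)) /\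
    \int[P]_w (X w * W w) = 0.
  move=> aX iX; have XW := incr_indep F_filtration B_brownian (t_ge0 m) (t_incr m) aX.
  split; first exact: indep_integrableM.
  by rewrite indep_integralM// (incr_mean0 F_filtration B_brownian)// mulr0.
have i1 : P.-integrable setT (EFin \o (cst 1 : Omega -> R)).
  exact: finite_measure_integrable_cst.
have iZ : P.-integrable setT (EFin \o Z m).
  have := bounded_integrableM (mZ m) (ZC m) i1.
  by apply: eq_integrable => // w _ /=; rewrite mulr1.
have iZS : P.-integrable setT (EFin \o (fun w => Z m w * S w)).
  exact: (bounded_integrableM (mZ m) (ZC m)).
have aZS : adapted_at F (t_ m) (fun w => Z m w * S w).
  by apply: measurable_funM; [exact: aZ|exact: aS].
have [iZW eZW] := i0 _ (@aZ m) iZ.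
have [iZSW eZSW] := i0 _ aZS iZS.
have iZ2W2 : P.-integrable setT (EFin \o (fun w => Z m w ^+ 2 * W w ^+ 2)).
  apply: (@bounded_integrableM (fun w => Z m w ^+ 2) _ (C ^+ 2)) => //.
    by apply: measurable_funX; exact: mZ.
  move=> w; rewrite normrX; have := ZC m w; have := normr_ge0 (Z m w); nra.
have iSq : P.-integrable setT (EFin \o (fun w => S w ^+ 2 + 2 * (Z m w * S w * W w))).
  have i2 := integrableZl measurableT 2 iZSW.
  by have := integrableD measurableT IH1 i2.
have Esq : (fun w => transform Z m.+1 w ^+ 2) = (fun w => S w ^+ 2 +
    2 * (Z m w * S w * W w) + Z m w ^+ 2 * W w ^+ 2).
  by apply/funext => w; rewrite E; ring.
split.
- by rewrite Esq; have := integrableD measurableT iSq iZ2W2.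
- by rewrite E RintegralD// eZW addr0.
- rewrite (_ : \int[P]_w _ = \int[P]_w (S w ^+ 2 +
    2 * (Z m w * S w * W w) + Z m w ^+ 2 * W w ^+ 2)); last by rewrite -Esq.
  rewrite RintegralD// RintegralD//; last by have := integrableZl measurableT 2 iZSW.
  by rewrite RintegralZl// eZSW mulr0 addr0 big_ord_recr/= IH3.
Qed.

End bounded.

(** For [Z = 1] the transform telescopes to a single increment. Comparing with
that case bounds the second moment uniformly in the grid, without knowing the
variance of an increment. *)
Lemma transform_sqr_le (Z : nat -> Omega -> R) (C : R) m :
  (forall k, adapted_at F (t_ k) (Z k)) -> (forall k w, `|Z k w| <= C) ->
  \int[P]_w (transform Z m w ^+ 2) <=
  C ^+ 2 * \int[P]_w (incr B (t_ 0%N) (t_ m) w ^+ 2).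
Proof.
move=> aZ ZC.
have a1 k : adapted_at F (t_ k) (cst 1 : Omega -> R) by exact: measurable_cst.
have one (k : nat) (w : Omega) : `|(cst 1 : Omega -> R) w| <= 1 by rewrite /= normr1.
have tel w : transform (fun=> cst 1) m w = incr B (t_ 0%N) (t_ m) w.
  rewrite /transform; elim: m => [|m IH]; first by rewrite big_ord0 /incr subrr.
  by rewrite big_ord_recr/= IH /incr/=; ring.
have [_ _ e1] := transform_moments a1 one m.
have [_ _ ->] := transform_moments aZ ZC m.
have -> : \int[P]_w (incr B (t_ 0%N) (t_ m) w ^+ 2) =
    \int[P]_w (transform (fun=> cst 1) m w ^+ 2).
  by apply: eq_Rintegral => w _; rewrite tel.
rewrite e1 mulr_sumr; apply: ler_sum => k _.
have iW2 : P.-integrable setT (EFin \o (fun w => incr B (t_ k) (t_ k.+1) w ^+ 2)).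
  exact: (incr_sqr_integrable F_filtration B_brownian).
have C2 w : `|Z k w ^+ 2| <= C ^+ 2.
  by rewrite normrX; have := ZC k w; have := normr_ge0 (Z k w); nra.
rewrite -RintegralZl//; last first.
  by apply: eq_integrable iW2 => // w _ /=; rewrite expr1n mul1r.
apply: le_Rintegral => //.
- apply: (bounded_integrableM _ C2) => //.
  by apply: measurable_funX; exact: (adapted_at_measurable F_filtration (t_ge0 k)).
- have := integrableZl measurableT (C ^+ 2) iW2.
  by apply: eq_integrable => // w _ /=; rewrite expr1n mul1r.
- move=> w _; rewrite /= expr1n mul1r; apply: ler_wpM2r; first exact: sqr_ge0.
  by apply: le_trans (C2 w); exact: ler_norm.
Qed.

End martingale_transform.

(** * Limits almost everywhere on a complete space *)

Section complete_measure.
Context d (T : measurableType d) (R : realType) (P : probability T R).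

Lemma bounded_integrable (f : T -> R) (K : R) : measurable_fun setT f ->
  (forall w, `|f w| <= K) -> P.-integrable setT (EFin \o f).
Proof.
move=> mf fK; apply: measurable_bounded_integrable => //.
  exact: fin_num_fun_lty.
by exists K; split; [exact: num_real|move=> x Kx w _ /=; exact: le_trans (ltW Kx)].
Qed.

Hypothesis cP : measure_is_complete P.

Lemma measurable_ae (f g : T -> R) : {ae P, forall w, f w = g w} ->
  measurable_fun setT f -> measurable_fun setT g.
Proof.
move=> fg mf; apply/measurable_EFinP.
apply: (@ae_measurable_fun _ _ _ P cP setT (EFin \o f)).
  by apply: filterS fg => w fgw _ /=; rewrite fgw.
exact/measurable_EFinP.
Qed.

(** Outside a measurable null set the convergence is pointwise; completeness
then allows any modification on the null set. *)
Lemma measurable_ae_cvg (f_ : nat -> T -> R) (f : T -> R) :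
  (forall n, measurable_fun setT (f_ n)) ->
  {ae P, forall w, f_ ^~ w @ \oo --> f w} -> measurable_fun setT f.
Proof.
move=> mf_ [N [mN N0 subN]].
apply: (@measurable_ae (f \_ (~` N))).
  exists N; split=> // w /= H; apply: contrapT => Nw; apply: H.
  by rewrite patchE mem_set.
apply: (@measurable_fun_cvg _ _ _ setT (fun n => f_ n \_ (~` N))).
  move=> n; apply/measurable_restrict => //; first exact: measurableC.
  by apply: measurable_funS (mf_ n).
move=> w _; have [wN|wN] := boolP (w \in ~` N); last first.
  by rewrite patchE (negbTE wN); under eq_fun do rewrite patchE (negbTE wN); exact: cvg_cst.
rewrite patchE wN; under eq_fun do rewrite patchE wN.
by apply: contrapT => H; move: wN; rewrite inE; apply; exact: subN.
Qed.

(** Dominated convergence where the measurability of the limit is a consequence,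
as needed for limits that are defined path by path. *)
Lemma dominated_Rintegral (f_ : nat -> T -> R) (f g : T -> R) :
  (forall n, measurable_fun setT (f_ n)) ->
  P.-integrable setT (EFin \o g) ->
  {ae P, forall w n, `|f_ n w| <= g w} ->
  {ae P, forall w, f_ ^~ w @ \oo --> f w} ->
  P.-integrable setT (EFin \o f) /\
  (fun n => \int[P]_w f_ n w) @ \oo --> \int[P]_w f w.
Proof.
move=> mf_ ig f_g f_f.
have mf := measurable_ae_cvg mf_ f_f.
have [] := @dominated_convergence _ _ _ P setT measurableT
  (fun n => EFin \o f_ n) (EFin \o f) (EFin \o g) _ _ _ ig _.
- by move=> n; exact/measurable_EFinP.
- exact/measurable_EFinP.
- by apply: filterS f_f => w H _; apply: cvg_EFin => //; exact: nearW.
- by apply: filterS f_g => w H n _ /=; rewrite lee_fin.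
move=> i_f _ cv; split=> //.
by apply: fine_cvg; rewrite /Rintegral fineK; [exact: cv|exact: integrable_fin_num].
Qed.

Lemma bounded_Rintegral (f_ : nat -> T -> R) (f : T -> R) (K : R) :
  (forall n, measurable_fun setT (f_ n)) ->
  {ae P, forall w n, `|f_ n w| <= K} ->
  {ae P, forall w, f_ ^~ w @ \oo --> f w} ->
  P.-integrable setT (EFin \o f) /\
  (fun n => \int[P]_w f_ n w) @ \oo --> \int[P]_w f w.
Proof.
move=> mf_ f_K f_f; apply: (@dominated_Rintegral _ _ (cst K)) => //.
exact: finite_measure_integrable_cst.
Qed.

End complete_measure.

(** * Truncation, paths and capped times *)

Section clip.
Context (R : realType).
Implicit Types (J z : R).

Definition clip J z : R := Num.max (- J) (Num.min J z).

Lemma clip_norm J z : 0 <= J -> `|clip J z| <= J.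
Proof. by move=> J0; rewrite /clip ler_norml !(le_max, ge_max, ge_min) !lexx/=; lra. Qed.

Lemma clip_id J z : `|z| <= J -> clip J z = z.
Proof. by rewrite ler_norml => /andP[z1 z2]; rewrite /clip min_r// max_r. Qed.

(** The error is quadratic, so that a bound in L2 controls the truncation of
variables that are not bounded. *)
Lemma clip_dist J z : 0 < J -> `|z - clip J z| <= z ^+ 2 / J.
Proof.
move=> J0; have [zJ|Jz] := leP `|z| J.
  by rewrite clip_id// subrr normr0 divr_ge0 ?sqr_ge0// ltW.
rewrite ler_pdivlMr// -[z ^+ 2]real_normK ?num_real//.
suff : `|z - clip J z| <= `|z| by have := normr_ge0 (z - clip J z); nra.
rewrite /clip; move: Jz; rewrite lter_normr => /orP[Jz|Jz].
  by rewrite min_l ?max_r ?ger0_norm; lra.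
by rewrite min_r ?max_l ?ler0_norm; lra.
Qed.

Lemma continuous_clip J : continuous (clip J).
Proof.
move=> z; apply: (@continuous_max R R (cst (- J)) (fun x => Num.min J x) z).
  exact: cst_continuous.
apply: (@continuous_min R R (cst J) id z); first exact: cst_continuous.
exact: cvg_id.
Qed.

Lemma measurable_clip J : measurable_fun [set: R] (clip J).
Proof. by apply: continuous_measurable_fun; exact: continuous_clip. Qed.

End clip.

Section paths.
Context (R : realType) (b : R -> R).
Hypothesis cb : {within `[0, +oo[, continuous b}.

Lemma path_continuous (u : R) : 0 <= u -> forall e, 0 < e -> exists2 r, 0 < r &
  forall v, 0 <= v -> `|v - u| < r -> `|b v - b u| < e.
Proof.
move=> u0 e e0.
have /(_ u) := (@subspace_continuousP _ _ _ _).1 cb.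
rewrite /= in_itv/= u0 => /(_ isT) /cvgrPdist_lt /(_ e e0).
rewrite /within /= => /nbhs_ballP [r r0 H].
exists r => // v v0 vu; rewrite distrC; apply: H.
  by rewrite /ball/= distrC.
by rewrite in_itv/= v0.
Qed.

Lemma path_cvg (u_ : nat -> R) (u : R) : (forall n, 0 <= u_ n) -> 0 <= u ->
  u_ @ \oo --> u -> b \o u_ @ \oo --> b u.
Proof.
move=> u_0 u0 cu; apply/cvgrPdist_lt => e e0.
have [r r0 H] := path_continuous u0 e0.
move/cvgrPdist_lt : cu => /(_ r r0); apply: filterS => n hn.
by rewrite distrC; apply: H => //; rewrite distrC.
Qed.

Lemma path_itv_continuous (x y : R) : 0 <= x -> {within `[x, y], continuous b}.
Proof.
move=> x0; apply: (continuous_subspaceW _ cb) => z /=.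
by rewrite !in_itv/= andbT => /andP[xz _]; exact: le_trans xz.
Qed.

End paths.

Section capped.
Context (R : realType).
Implicit Types (sigma : \bar R) (N : R).

Definition capped sigma N : R := fine (Order.min sigma N%:E).

Lemma cappedE sigma N : (0 <= sigma)%E ->
  ((capped sigma N)%:E = Order.min sigma N%:E)%E.
Proof.
move=> s0; rewrite /capped fineK//.
by case: sigma s0 => [r| |]//= _; rewrite -?EFin_min// min_r ?leey.
Qed.

Lemma capped_le sigma N : (0 <= sigma)%E -> capped sigma N <= N.
Proof. by move=> s0; rewrite -lee_fin cappedE// ge_min lexx orbT. Qed.

Lemma capped_le_time sigma N : (0 <= sigma)%E -> ((capped sigma N)%:E <= sigma)%E.
Proof. by move=> s0; rewrite cappedE// ge_min lexx. Qed.

Lemma capped_ge0 sigma N : (0 <= sigma)%E -> 0 <= N -> 0 <= capped sigma N.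
Proof. by move=> s0 N0; rewrite -lee_fin cappedE// le_min s0 lee_fin. Qed.

Lemma capped_fin (r N : R) : r <= N -> capped r%:E N = r.
Proof. by move=> rN; rewrite /capped min_l ?lee_fin. Qed.

Lemma capped_ge sigma N : (N%:E <= sigma)%E -> capped sigma N = N.
Proof. by move=> rN; rewrite /capped min_r. Qed.

(** The steps that start before [sigma] telescope, and the last of them ends less
than one mesh after [sigma]: [u] is the discretised stopping time. *)
Lemma grid_telescope (b : R -> R) (t_ : nat -> R) (mesh : R) sigma m :
  (0 <= sigma)%E -> 0 <= mesh -> t_ 0%N = 0 ->
  (forall k, t_ k <= t_ k.+1 <= t_ k + mesh) ->
  exists u, [/\ capped sigma (t_ m) <= u, u <= t_ m, u <= capped sigma (t_ m) + mesh &
    \sum_(k < m) ((t_ k)%:E < sigma)%E%:R * (b (t_ k.+1) - b (t_ k)) = b u - b 0].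
Proof.
move=> s0 mesh0 t0 tk; elim: m => [|m [u [u1 u2 u3 IH]]].
  exists 0; rewrite big_ord0 subrr t0 capped_ge//; split=> //; lra.
have /andP[tm1 tm2] := tk m.
have [st|ts] := leP sigma (t_ m)%:E.
  have [r rE] : exists r, sigma = r%:E by move: s0 st; case: (sigma) => // r; exists r.
  move: st u1 u2 u3 IH; rewrite rE lee_fin => st u1 u2 u3 IH.
  exists u; rewrite big_ord_recr/= IH lte_fin ltNge st/= mul0r addr0.
  rewrite capped_fin// in u1; rewrite capped_fin// in u3.
  rewrite capped_fin; last exact: le_trans tm1.
  by split=> //; apply: le_trans tm1.
rewrite (capped_ge (ltW ts)) in u1.
have utm : u = t_ m by apply/eqP; rewrite eq_le u2 u1.
exists (t_ m.+1); split=> //; first exact: capped_le.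
- apply: le_trans tm2 _; rewrite lerD2r.
  by rewrite -lee_fin cappedE// le_min (ltW ts) lee_fin.
- by rewrite big_ord_recr/= ts mul1r IH utm; ring.
Qed.

End capped.

(** * Optional stopping given the starting point *)

Section optional_stopping.
Context d (Omega : measurableType d) (R : realType) (P : probability Omega R).
Variables (mu : probability R R) (F : R -> set (set Omega)) (B : R -> Omega -> R).
Hypotheses (F_filtration : filtration F) (F_usual : usual_conditions P F).
Hypothesis B_brownian : brownian_motion P F mu B.

(** The null sets belong to [F 0], and [F 0] consists of measurable sets. *)
Lemma usual_complete : measure_is_complete P.
Proof.
move=> A nA; have [_ FM _] := F_filtration.
by apply: (FM 0) => //; have [] := F_usual => + _; apply.
Qed.

Lemma B_continuous : {ae P, forall w, {within `[0, +oo[, continuous (B ^~ w)}}.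
Proof. by have [] := B_brownian. Qed.

Variable sigma : Omega -> \bar R.
Hypothesis sigmaS : stopping_time F sigma.

Let sigma0 w : (0 <= sigma w)%E. Proof. by have [] := sigmaS. Qed.

Lemma stopping_indic_adapted t : 0 <= t ->
  adapted_at F t (fun w => ((t%:E < sigma w)%E)%:R : R).
Proof.
move=> t0; have [_ /(_ t t0) FS] := sigmaS.
have -> : (fun w => ((t%:E < sigma w)%E)%:R : R) =
    \1_(~` [set w | (sigma w <= t%:E)%E]).
  apply/funext => w; rewrite indicE in_setC; congr (_%:R); rewrite ltNge; congr (~~ _).
  by apply/idP/idP; rewrite inE.
apply: measurable_indic; apply: measurableC.
exact/(F_measurable F_filtration).
Qed.

Definition stopped_incr N w := B (capped (sigma w) N) w - B 0 w.

Section horizon.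
Variable N : R.
Hypothesis N0 : 0 < N.

Let t_ n (k : nat) : R := k%:R * (N / n.+1%:R).
Let mesh_gt0 n : 0 < N / n.+1%:R. Proof. by rewrite divr_gt0. Qed.
Let t_lt n k : t_ n k < t_ n k.+1.
Proof. by rewrite /t_ ltr_pM2r// ltr_nat. Qed.
Let t_0 n : t_ n 0%N = 0. Proof. by rewrite /t_ mul0r. Qed.
Let t_N n : t_ n n.+1 = N.
Proof. by rewrite /t_ mulrC divfK// pnatr_eq0. Qed.
Let t_ge0 n k : 0 <= t_ n k. Proof. by rewrite mulr_ge0// ltW. Qed.

Let Z n k w : R := ((t_ n k)%:E < sigma w)%E%:R.
Let S n w := transform B (t_ n) (Z n) n.+1 w.

Let S_cvg : {ae P, forall w, S ^~ w @ \oo --> stopped_incr N w}.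
Proof.
apply: filterS B_continuous => w cb.
have /choice[u uP] : forall n, exists u, [/\ capped (sigma w) N <= u, u <= N,
    u <= capped (sigma w) N + N / n.+1%:R & S n w = B u w - B 0 w].
  move=> n.
  have [|u [u1 u2 u3 u4]] := @grid_telescope R (B ^~ w) (t_ n) (N / n.+1%:R)
      (sigma w) n.+1 (sigma0 w) (ltW (mesh_gt0 n)) (t_0 n).
    by move=> k; rewrite ltW//= /t_ -natr1 mulrDl mul1r.
  by rewrite t_N in u1 u2 u3; exists u; split.
have c0 : 0 <= capped (sigma w) N by apply: capped_ge0 => //; exact: ltW.
have -> : S ^~ w = (fun n => B (u n) w - B 0 w).
  by apply/funext => n; have [_ _ _ ->] := uP n.
apply: cvgB; last exact: cvg_cst.
apply: (@path_cvg _ _ cb u) => //.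
  by move=> n; have [h _ _ _] := uP n; exact: le_trans h.
apply: (@squeeze_cvgr _ _ _ _ (cst (capped (sigma w) N))
   (fun n => capped (sigma w) N + N * n.+1%:R^-1)).
- by apply: nearW => n; have [h1 _ h2 _] := uP n; rewrite h1.
- exact: cvg_cst.
- rewrite -[X in _ --> X]addr0; apply: cvgD; first exact: cvg_cst.
  rewrite -[X in _ --> X](mulr0 N); apply: cvgM; first exact: cvg_cst.
  exact: cvg_harmonic.
Qed.

Let aZ n k : adapted_at F (t_ n k) (Z n k).
Proof. exact: stopping_indic_adapted. Qed.

Let mS n : measurable_fun setT (S n).
Proof.
apply: (adapted_at_measurable F_filtration (t_ge0 n n.+1)).
apply: (transform_adapted F_filtration B_brownian) => //.
Qed.

Lemma measurable_stopped_incr : measurable_fun setT (stopped_incr N).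
Proof. exact: (measurable_ae_cvg usual_complete mS S_cvg). Qed.

(** The discretised increments [hS n] are centred, bounded in L2 by a constant
independent of [n], and converge to the stopped increment, but they overshoot
and so are not bounded. Truncating them at level [J >= K] leaves the limit
unchanged, costs at most [v / J], and allows bounded convergence; then [J] is
arbitrary. *)
Lemma optional_stopping_bounded (h : Omega -> R) (C K : R) :
  adapted_at F 0 h -> (forall w, `|h w| <= C) ->
  {ae P, forall w, `|h w * stopped_incr N w| <= K} ->
  \int[P]_w (h w * stopped_incr N w) = 0.
Proof.
move=> ah hC hK; set X := fun w => _.
have mh : measurable_fun setT h by exact: (adapted_at_measurable F_filtration (lexx 0)).
(* the bound of the second moments, common to all grids *)
pose v := C ^+ 2 * \int[P]_w (incr B 0 N w ^+ 2).
have v0 : 0 <= v.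
  by rewrite mulr_ge0 ?sqr_ge0// Rintegral_ge0// => w _; exact: sqr_ge0.
suff key J : 0 < J -> K <= J -> `|\int[P]_w X w| <= v / J.
  apply/eqP; rewrite -normr_le0; apply/ler_addgt0Pl => e e0; rewrite addr0.
  pose J := Num.max 1 (Num.max K (v / e)).
  have J1 : 1 <= J by rewrite le_max lexx.
  have JK : K <= J by rewrite !le_max lexx orbT.
  have Jv : v / e <= J by rewrite !le_max lexx !orbT.
  apply: le_trans (key J _ JK) _; first lra.
  by rewrite ler_pdivrMr; [rewrite mulrC -ler_pdivrMr|lra].
move=> J0 KJ.
pose hS n w := h w * S n w.
have hSE n : hS n = transform B (t_ n) (fun k w => h w * Z n k w) n.+1.
  apply/funext => w; rewrite /hS /S /transform mulr_sumr.
  by apply: eq_bigr => k _; rewrite mulrA.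
have mhS n : measurable_fun setT (hS n) by exact: measurable_funM.
have a_hZ n k : adapted_at F (t_ n k) (fun w => h w * Z n k w).
  apply: measurable_funM; last exact: aZ.
  exact: (adapted_at_le F_filtration (lexx 0)).
have hZC n k w : `|h w * Z n k w| <= C.
  rewrite normrM /Z; case: (_ < _)%E; first by rewrite normr1 mulr1.
  by rewrite normr0 mulr0; apply: le_trans (hC w).
have t00 n : 0 <= t_ n 0%N by rewrite t_0.
have X_clip : {ae P, forall w, (fun n => clip J (hS n w)) @ \oo --> X w}.
  apply: filterS2 hK S_cvg => w XK Sw.
  rewrite -(@clip_id _ J (X w)); last exact: le_trans KJ.
  apply: continuous_cvg; first exact: continuous_clip.
  by apply: cvgM Sw; exact: cvg_cst.
have mclip n : measurable_fun setT (fun w => clip J (hS n w)).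
  by apply: measurableT_comp (mhS n); exact: measurable_clip.
have clipJ w n : `|clip J (hS n w)| <= J by apply: clip_norm; exact: ltW.
have [_ cvX] := @bounded_Rintegral _ _ _ P usual_complete
  (fun n w => clip J (hS n w)) X J mclip (aeW _ clipJ) X_clip.
apply: (cvgr_to_le (cvg_norm cvX)); apply: nearW => n.
have iclip : P.-integrable setT (EFin \o (fun w => clip J (hS n w))).
  by apply: (@bounded_integrable _ _ _ _ _ J).
have [i2 e1 _] := transform_moments F_filtration B_brownian (t00 n) (t_lt n)
  (a_hZ n) (hZC n) n.+1.
have le2 := transform_sqr_le F_filtration B_brownian (t00 n) (t_lt n) n.+1
  (a_hZ n) (hZC n).
rewrite -!hSE in i2 e1 le2; rewrite t_0 t_N -/v in le2.
have i1 : P.-integrable setT (EFin \o hS n) by exact: sqr_integrable.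
have -> : \int[P]_w clip J (hS n w) = - \int[P]_w (hS n w - clip J (hS n w)).
  by rewrite RintegralB// e1; ring.
have i12 : P.-integrable setT (EFin \o (fun w => hS n w - clip J (hS n w))).
  by have := integrableB measurableT i1 iclip.
rewrite normrN; apply: le_trans (le_normr_Rintegral measurableT i12) _.
have i2J : P.-integrable setT (EFin \o (fun w => J^-1 * hS n w ^+ 2)).
  by have := integrableZl measurableT (J^-1) i2.
apply: (@le_trans _ _ (\int[P]_w (J^-1 * hS n w ^+ 2))).
  apply: le_Rintegral => //; first exact: integrable_norm.
  by move=> w _; rewrite mulrC; exact: clip_dist.
by rewrite RintegralZl// mulrC ler_pM2r// invr_gt0.
Qed.

(** An unbounded weight is the limit of its restrictions to the events where it
is bounded by [n]; the bound [K] on the product is all that the limit needs.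
This matters for the weight 1 / (hi - lo). *)
Lemma optional_stopping_horizon (h : Omega -> R) (K : R) :
  adapted_at F 0 h ->
  {ae P, forall w, `|h w * stopped_incr N w| <= K} ->
  P.-integrable setT (EFin \o (fun w => h w * stopped_incr N w)) /\
  \int[P]_w (h w * stopped_incr N w) = 0.
Proof.
move=> ah hK.
have mh : measurable_fun setT h by exact: (adapted_at_measurable F_filtration (lexx 0)).
pose h_ (n : nat) w : R := (`|h w| <= n%:R)%R%:R * h w.
have ah_ n : adapted_at F 0 (h_ n).
  apply: measurable_funM => //.
  have -> : (fun w => (`|h w| <= n%:R)%R%:R : R) =
      \1_((fun w => `|h w| <= n%:R) @^-1` [set true]).
    apply/funext => w; rewrite indicE; congr ((nat_of_bool _)%:R); apply/idP/idP.
      by move=> ?; rewrite inE.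
    by rewrite inE.
  apply: measurable_indic; rewrite -[X in measurable X]setTI.
  by apply: measurable_fun_ler => //; apply: measurableT_comp => //; exact: ah.
have h_n n w : `|h_ n w| <= n%:R.
  by rewrite /h_; have [hn|_] := leP `|h w| n%:R; rewrite ?mul1r// mul0r normr0.
have h_h n w : `|h_ n w| <= `|h w|.
  by rewrite /h_; have [hn|_] := leP `|h w| n%:R; rewrite ?mul1r// mul0r normr0.
have mX := measurable_stopped_incr.
have [|||i_h cv] := @bounded_Rintegral _ _ _ P usual_complete
  (fun n w => h_ n w * stopped_incr N w) (fun w => h w * stopped_incr N w) K.
- by move=> n; apply: measurable_funM => //; apply: (adapted_at_measurable F_filtration (lexx 0)).
- apply: filterS hK => w hKw n; apply: le_trans hKw.
  by rewrite [leLHS]normrM [leRHS]normrM; apply: ler_wpM2r => //; exact: h_h.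
- apply: aeW => w; apply: cvgM; last exact: cvg_cst.
  apply: cvg_near_cst; near=> n; rewrite /h_ (_ : (_ <= _)%R = true) ?mul1r//.
  by near: n; exact: nbhs_infty_ger.
split=> //; apply/eqP; rewrite eq_sym; apply/eqP.
have E : (fun n => \int[P]_w (h_ n w * stopped_incr N w)) = cst 0.
  apply/funext => n; apply: (optional_stopping_bounded (ah_ n) (h_n n) (K := K)).
  apply: filterS hK => w hKw; apply: le_trans hKw.
  by rewrite [leLHS]normrM [leRHS]normrM; apply: ler_wpM2r => //; exact: h_h.
move: cv; rewrite E => cv; apply: cvg_unique cv => //; exact: cvg_cst.
Unshelve. all: by end_near.
Qed.

End horizon.

Hypothesis sigma_fin : {ae P, forall w, (sigma w < +oo)%E}.

Lemma stopped_incr_cvg : {ae P, forall w,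
  (fun n => stopped_incr n.+1%:R w) @ \oo --> stopped B sigma w - B 0 w}.
Proof.
apply: filterS sigma_fin => w sf; apply: cvg_near_cst; near=> n.
have sE : (fine (sigma w))%:E = sigma w.
  by rewrite fineK// ge0_fin_numE.
rewrite /stopped_incr /stopped -sE capped_fin//.
apply: (@le_trans _ _ n%:R); last by rewrite ler_nat.
by near: n; exact: nbhs_infty_ger.
Unshelve. all: by end_near.
Qed.

Lemma measurable_stopped : measurable_fun setT (stopped B sigma).
Proof.
have m := measurable_ae_cvg usual_complete
  (fun n => measurable_stopped_incr (ltr0Sn R n)) stopped_incr_cvg.
have -> : stopped B sigma = (fun w => (stopped B sigma w - B 0 w) + B 0 w).
  by apply/funext => w; rewrite subrK.
by apply: measurable_funD => //; exact: (measurable_B F_filtration B_brownian).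
Qed.

(** The bound holds uniformly in the horizon, so bounded convergence lets the
horizon tend to infinity. The weight [h] encodes conditioning on [F 0]. *)
Lemma optional_stopping (h : Omega -> R) (K : R) : adapted_at F 0 h ->
  {ae P, forall w, forall N, 0 < N -> `|h w * stopped_incr N w| <= K} ->
  P.-integrable setT (EFin \o (fun w => h w * (stopped B sigma w - B 0 w))) /\
  \int[P]_w (h w * (stopped B sigma w - B 0 w)) = 0.
Proof.
move=> ah hK.
have mh : measurable_fun setT h by exact: (adapted_at_measurable F_filtration (lexx 0)).
have [|||i_h cv] := @bounded_Rintegral _ _ _ P usual_complete
  (fun n w => h w * stopped_incr n.+1%:R w)
  (fun w => h w * (stopped B sigma w - B 0 w)) K.
- by move=> n; apply: measurable_funM => //; exact: measurable_stopped_incr.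
- by apply: filterS hK => w hKw n; exact: hKw.
- by apply: filterS stopped_incr_cvg => w; apply: cvgM; exact: cvg_cst.
split=> //; move: cv.
have -> : (fun n => \int[P]_w (h w * stopped_incr n.+1%:R w)) = cst 0.
  apply/funext => n; have [] := @optional_stopping_horizon n.+1%:R (ltr0Sn R n) h K => //.
  by apply: filterS hK => w hKw; exact: hKw.
by move=> cv; apply/esym/(cvg_unique _ _ cv) => //; exact: cvg_cst.
Qed.

End optional_stopping.

(** * Hitting times *)

Section first_time.
Context (R : realType).
Implicit Types (A : set R) (x : \bar R).

Definition first_time A : \bar R := ereal_inf [set t%:E | t in A].

Lemma first_time_le A t : A t -> (first_time A <= t%:E)%E.
Proof. by move=> At; apply: ereal_inf_lbound; exists t. Qed.

Lemma first_time_ge A x : (forall t, A t -> (x <= t%:E)%E) -> (x <= first_time A)%E.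
Proof. by move=> H; apply: le_ereal_inf_tmp => _ [t At <-]; exact: H. Qed.

Lemma first_time_lt A x : (first_time A < x)%E -> exists2 t, A t & (t%:E < x)%E.
Proof. by move=> /ereal_inf_lt[_ [t At <-] tx]; exists t. Qed.

End first_time.

Section path_hits.
Context (R : realType) (x : R -> R).
Hypothesis cx : {within `[0, +oo[, continuous x}.

Definition closed_hits : set R := [set t | 0 <= t /\ 0 <= x t].
Definition open_hits : set R := [set t | 0 <= t /\ 0 < x t].

(** If the path were negative at the infimum of its hits, it would be negative on
a right neighbourhood, and hits could not accumulate there. *)
Lemma closed_hit_attained r : first_time closed_hits = r%:E -> 0 <= r /\ 0 <= x r.
Proof.
move=> rE; have r0 : 0 <= r.
  by rewrite -lee_fin -rE; apply: first_time_ge => t [t0 _]; rewrite lee_fin.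
split=> //; rewrite leNgt; apply/negP => xr.
have nx0 : 0 < - x r by lra.
have [e e0 H] := path_continuous cx r0 nx0.
have /first_time_lt[t [t0 xt]] : (first_time closed_hits < (r + e)%:E)%E.
  by rewrite rE lte_fin ltrDl.
have rt : r <= t by rewrite -lee_fin -rE; apply: first_time_le; split.
rewrite lte_fin => te.
have := H t t0; rewrite ger0_norm ?subr_ge0// ltrBlDl te => /(_ isT).
by rewrite ltr_distl => /andP[_]; lra.
Qed.

(** Forcing a rational time into [0, t] makes [t] itself available as a sampling
time, so that rational times to the right of a hit are enough. *)
Definition clamp t (q : rat) : R := Num.max 0 (Num.min t (ratr q)).

Lemma clamp_itv t q : 0 <= t -> 0 <= clamp t q <= t.
Proof. by move=> t0; rewrite /clamp le_max lexx/= ge_max t0 ge_min lexx. Qed.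

(** A maximum on [0, t] that exceeds every [- n.+1%:R^-1] is nonnegative. The
right-hand side involves countably many times, all of them at most [t]. *)
Lemma closed_hit_leP t : 0 <= t -> (first_time closed_hits <= t%:E)%E <->
  forall n : nat, exists q : rat, - n.+1%:R^-1 < x (clamp t q).
Proof.
move=> t0; split=> [ht n|H].
  have [r rE] : exists r, first_time closed_hits = r%:E.
    have h0 : (0 <= first_time closed_hits)%E.
      by apply: first_time_ge => u [u0 _]; rewrite lee_fin.
    by case: first_time h0 ht => // r _ _; exists r.
  have [r0 xr0] := closed_hit_attained rE.
  rewrite rE lee_fin in ht.
  have n0 : (0 : R) < n.+1%:R^-1 by rewrite invr_gt0.
  have [e e0 He] := path_continuous cx r0 n0.
  have /rat_in_itvoo[q] : r < r + e by rewrite ltrDl.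
  rewrite in_itv/= => /andP[rq qe]; exists q.
  have c1 : r <= clamp t q by rewrite /clamp le_max le_min ht (ltW rq) orbT.
  have c2 : clamp t q < r + e by rewrite /clamp gt_max gt_min qe orbT andbT; lra.
  have := He (clamp t q) (le_trans r0 c1).
  rewrite ger0_norm ?subr_ge0// ltrBlDl c2 => /(_ isT).
  rewrite ltr_distl => /andP[+ _]; apply: le_lt_trans.
  by rewrite -[leLHS]add0r lerD2r.
have [c c1 c2] := @EVT_max R x 0 t t0 (@path_itv_continuous _ _ cx 0 t (lexx 0)).
have xc : 0 <= x c.
  rewrite leNgt; apply/negP => xc0.
  have xcn : 0 < - x c by lra.
  pose n := Num.bound (- x c)^-1.
  have [q xq] := H n.
  have xqc : x (clamp t q) <= x c by apply: c2; rewrite in_itv/=; exact: clamp_itv.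
  have : (- x c)^-1 < n.+1%:R.
    apply: lt_trans (_ : n%:R < _); last by rewrite ltr_nat.
    by apply: archi_boundP; rewrite invr_ge0 ltW.
  rewrite -[ltRHS]invrK ltf_pV2 ?posrE ?invr_gt0//.
  by move: xq; set e := n.+1%:R^-1; lra.
move: c1; rewrite in_itv/= => /andP[c0 ct].
by apply: le_trans (first_time_le (_ : closed_hits c)) _ => //; rewrite lee_fin.
Qed.

Lemma open_hit_ltP s : (first_time open_hits < s%:E)%E <->
  exists q : rat, (0 <= ratr q :> R) /\ ratr q < s /\ 0 < x (ratr q).
Proof.
split=> [/first_time_lt[t [t0 xt]]|[q [q0 [qs xq]]]]; last first.
  by apply: le_lt_trans (first_time_le (_ : open_hits (ratr q))) _ => //; rewrite lte_fin.
rewrite lte_fin => ts.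
have [e e0 He] := path_continuous cx t0 xt.
have /rat_in_itvoo[q] : t < Num.min s (t + e) by rewrite lt_min ts ltrDl.
rewrite in_itv/= lt_min => /and3P[tq qs qe]; exists q.
have q0 : 0 <= ratr q :> R by apply: le_trans t0 (ltW tq).
split=> //; split=> //.
have := He (ratr q) q0; rewrite ger0_norm ?subr_ge0 1?ltW// ltrBlDl qe => /(_ isT).
by rewrite ltr_distl => /andP[]; lra.
Qed.

End path_hits.

Section stopping_times.
Context d (Omega : measurableType d) (R : realType) (P : probability Omega R).
Variables (F : R -> set (set Omega)).
Hypotheses (F_filtration : filtration F) (F_usual : usual_conditions P F).

(** All negligible sets are in [F 0]. *)
Lemma F_ae t (A A' : set Omega) : 0 <= t -> F t A ->
  {ae P, forall w, A w <-> A' w} -> F t A'.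
Proof.
move=> t0 FA AA'.
have F0 N : P.-negligible N -> F t N.
  move=> nN; have [_ _] := F_filtration; apply; [exact: lexx|exact: t0|].
  by have [+ _] := F_usual; apply.
have n1 : F t (A `\` A').
  apply: F0; apply: negligibleS AA' => w [Aw nA'w] /= H; exact/nA'w/H.
have n2 : F t (A' `\` A).
  apply: F0; apply: negligibleS AA' => w [Aw nA'w] /= H; exact/nA'w/H.
have -> : A' = (A `\` (A `\` A')) `|` (A' `\` A).
  apply/seteqP; split=> w.
    by move=> A'w; have [Aw|nAw] := pselect (A w); [left; split=> // -[_]|right].
  by move=> [[Aw H]|[]//]; apply: contrapT => H'; apply: H.
move: FA n1 n2; rewrite !(F_measurable F_filtration)// => FA n1 n2.
by apply: measurableU => //; exact: measurableD.
Qed.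

(** Right-continuity of the filtration: the event [tau <= t] is decided
immediately after [t]. *)
Lemma stopping_time_of_lt (tau : Omega -> \bar R) : (forall w, 0 <= tau w)%E ->
  (forall t : R, 0 < t -> F t [set w | (tau w < t%:E)%E]) -> stopping_time F tau.
Proof.
move=> tau0 Flt; split=> // t t0.
have [_ /(_ t t0) ->] := F_usual; move=> s /= ts.
have s0 : 0 <= s by lra.
have -> : [set w | (tau w <= t%:E)%E] =
    \bigcap_n [set w | (tau w < (t + (s - t) / n.+1%:R)%:E)%E].
  apply/seteqP; split=> w /= H.
    move=> n _ /=; apply: le_lt_trans H _; rewrite lte_fin ltrDl divr_gt0//.
    by rewrite subr_gt0.
  apply/lee_addgt0Pr => e e0.
  pose n := Num.bound ((s - t) / e).
  apply: le_trans (ltW (H n I)) _; rewrite -EFinD lee_fin lerD2l.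
  rewrite ler_pdivrMr// mulrC -ler_pdivrMr//.
  apply: (@le_trans _ _ n%:R); last by rewrite ler_nat.
  by apply/ltW/archi_boundP; rewrite divr_ge0// ltW// subr_gt0.
apply/(F_measurable F_filtration) => //; apply: bigcapT_measurable => n.
apply/(F_measurable F_filtration) => //.
have n1 : (s - t) / n.+1%:R <= s - t.
  rewrite ler_pdivrMr//; apply: ler_peMr; first by rewrite subr_ge0 ltW.
  by rewrite ler1n.
have n0 : 0 < (s - t) / n.+1%:R by rewrite divr_gt0// subr_gt0.
have [_ _ mono] := F_filtration.
move: n0 n1; set e := (s - t) / n.+1%:R => n0 n1.
have te0 : 0 < t + e by lra.
have tes : t + e <= s by lra.
exact: (mono (t + e) s (ltW te0) tes _ (Flt _ te0)).
Qed.

Lemma stopping_time_ae (sigma tau : Omega -> \bar R) : stopping_time F sigma ->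
  (forall w, 0 <= tau w)%E -> {ae P, forall w, sigma w = tau w} ->
  stopping_time F tau.
Proof.
move=> [_ Fs] tau0 st; split=> // t t0; apply: (F_ae t0 (Fs t t0)).
by apply: filterS st => w /= ->.
Qed.

Lemma stopping_time_min (sigma tau : Omega -> \bar R) : stopping_time F sigma ->
  stopping_time F tau -> stopping_time F (fun w => Order.min (sigma w) (tau w)).
Proof.
move=> [s0 Fs] [t0 Ft]; split=> [w|t t_0]; first by rewrite le_min s0 t0.
have -> : [set w | (Order.min (sigma w) (tau w) <= t%:E)%E] =
    [set w | (sigma w <= t%:E)%E] `|` [set w | (tau w <= t%:E)%E].
  by apply/seteqP; split=> w /=; rewrite ge_min => /orP.
apply/(F_measurable F_filtration) => //; apply: measurableU.
  by apply/(F_measurable F_filtration) => //; exact: Fs.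
by apply/(F_measurable F_filtration) => //; exact: Ft.
Qed.

Section hits.
Variable X : R -> Omega -> R.
Hypothesis aX : forall t, 0 <= t -> adapted_at F t (X t).
Hypothesis cX : {ae P, forall w, {within `[0, +oo[, continuous (X ^~ w)}}.

Definition closed_hit w := first_time (closed_hits (X ^~ w)).
Definition open_hit w := first_time (open_hits (X ^~ w)).

Lemma closed_hit_ge0 w : (0 <= closed_hit w)%E.
Proof. by apply: first_time_ge => t [t0 _]; rewrite lee_fin. Qed.

Lemma open_hit_ge0 w : (0 <= open_hit w)%E.
Proof. by apply: first_time_ge => t [t0 _]; rewrite lee_fin. Qed.

Let F_gt t s c : 0 <= s -> s <= t -> F t [set w | c < X s w].
Proof.
move=> s0 st; have [_ _] := F_filtration; apply; [exact: s0|exact: st|].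
have -> : [set w | c < X s w] = X s @^-1` `]c, +oo[%classic.
  by apply/seteqP; split=> w /=; rewrite in_itv/= andbT.
by have /(adapted_atP F_filtration _ s0) := aX s0; apply; exact: measurable_itv.
Qed.

Lemma closed_hit_stopping : stopping_time F closed_hit.
Proof.
split=> [w|t t0]; first exact: closed_hit_ge0.
apply: (@F_ae t (\bigcap_n \bigcup_(q : rat)
    [set w | - n.+1%:R^-1 < X (clamp t q) w])) => //.
  apply/(F_measurable F_filtration) => //; apply: bigcapT_measurable => n.
  apply: bigcupT_measurable_rat => q; apply/(F_measurable F_filtration) => //.
  by have /andP[] := clamp_itv q t0; exact: F_gt.
apply: filterS cX => w cw /=; rewrite /closed_hit closed_hit_leP//; split.
  by move=> H n; have [q _ /= xq] := H n I; exists q.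
by move=> H n _; have [q xq] := H n; exists q.
Qed.

Lemma open_hit_stopping : stopping_time F open_hit.
Proof.
apply: stopping_time_of_lt; first exact: open_hit_ge0.
move=> t t0; have t0' := ltW t0.
apply: (@F_ae t (\bigcup_(q : rat)
    (if (0 <= ratr q :> R) && (ratr q < t) then [set w | 0 < X (ratr q) w] else set0))) => //.
  apply/(F_measurable F_filtration) => //.
  apply: bigcupT_measurable_rat => q; case: ifPn => [/andP[q0 qt]|_] //.
  by apply/(F_measurable F_filtration) => //; apply: F_gt => //; exact: ltW.
apply: filterS cX => w cw /=; rewrite /open_hit open_hit_ltP//; split.
  by move=> [q _]; case: ifPn => // /andP[q0 qt] /= xq; exists q.
by move=> [q [q0 [qt xq]]]; exists q => //; rewrite q0 qt.
Qed.

End hits.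
End stopping_times.

(** * The maps and the barrier *)

Section right_open.
Context (R : realType).
Implicit Types D : set R.

Lemma subsingleton_measurable D : (forall x y, D x -> D y -> x = y) -> measurable D.
Proof.
move=> D1; have [[x Dx]|D0] := pselect (D !=set0).
  have -> : D = [set x] by apply/seteqP; split=> y; [move=> Dy; exact: D1|move=> ->].
  exact: measurable_set1.
have -> : D = set0 by apply/seteqP; split=> y // Dy; apply: D0; exists y.
exact: measurable0.
Qed.

(** Such a set is open up to a countable set. A rational in the right
neighbourhood of a non-interior point determines that point, since otherwise
the right one of two such points would be interior to the neighbourhood of the
left one. *)
Lemma right_open_measurable D :
  (forall x, D x -> exists2 z, x < z & `[x, z[%classic `<=` D) -> measurable D.
Proof.
move=> Dro.
have oI : measurable (interior D) by apply: open_measurable; exact: open_interior.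
have /choice[q qP] : forall x, exists q : rat, D x ->
    x < ratr q /\ `[x, ratr q[%classic `<=` D.
  move=> x; have [Dx|nDx] := pselect (D x); last by exists 0.
  have [z xz zD] := Dro x Dx; have /rat_in_itvoo[q] := xz.
  rewrite in_itv/= => /andP[xq qz]; exists q => _; split=> // y /=.
  by rewrite in_itv/= => /andP[xy yq]; apply: zD; rewrite /= in_itv/= xy (lt_trans yq).
have -> : D = interior D `|` \bigcup_(p : rat) ((D `\` interior D) `&` [set x | q x = p]).
  apply/seteqP; split=> x; last by move=> [/interior_subset//|[p _ [[]]]].
  move=> Dx; have [Ix|nIx] := pselect (interior D x); [by left|right].
  by exists (q x).
apply: measurableU => //; apply: bigcupT_measurable_rat => p.
have lt_case x y : (D `\` interior D) x -> (D `\` interior D) y -> q x = q y -> ~ x < y.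
  move=> [Dx _] [Dy nIy] qxy xy.
  have [_ xD] := qP x Dx; have [yq _] := qP y Dy.
  have yI : y \in `]x, ratr (q x)[ by rewrite in_itv/= xy qxy.
  apply: nIy; move: (near_in_itvoo yI); rewrite /interior/=; apply: filterS => z.
  by rewrite /= in_itv/= => /andP[xz zq]; apply: xD; rewrite /= in_itv/= (ltW xz).
apply: subsingleton_measurable => x y [/= Dx qx] [/= Dy qy].
apply/eqP; rewrite eq_le; apply/andP; split; rewrite leNgt; apply/negP.
  by apply: lt_case => //; rewrite qx.
by apply: lt_case => //; rewrite qx.
Qed.

End right_open.

Section maps.
Context (R : realType) (Td Tu : R -> R).
Hypothesis T_le : forall x, Td x <= x <= Tu x.
Hypothesis T_fix : [set x | Td x = x] = [set x | Tu x = x].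
Hypothesis Tu_mono : {homo Tu : x y / x <= y}.
Hypothesis T_left : forall x y, x < y -> ~ (Td x < Td y < Tu x).

Lemma measurable_Tu : measurable_fun setT Tu.
Proof. exact: nondecreasing_measurable. Qed.

(** If [Td x < c <= x], then [Td] stays below [c] from [x] up to [Tu x], because
it cannot enter the interval from [Td x] to [Tu x] there. So, above [c], the
sublevel set of [Td] is right-open. *)
Lemma measurable_Td : measurable_fun setT Td.
Proof.
apply: (measurability _ (RGenInftyO.measurableE R)) => _ [_ [c ->] <-].
rewrite setTI.
have -> : Td @^-1` `]-oo, c[ = `]-oo, c[%classic `|` [set x | c <= x /\ Td x < c].
  apply/seteqP; split=> x /=; rewrite !in_itv/=.
    by move=> Tc; have [cx|xc] := leP c x; [right|left].
  by move=> [xc|[]//]; have /andP[Tx _] := T_le x; exact: le_lt_trans xc.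
apply: measurableU; first exact: measurable_itv.
apply: right_open_measurable => x [cx Tc].
have xTu : x < Tu x.
  have /andP[_ xTu] := T_le x; rewrite lt_neqAle xTu andbT.
  apply/eqP => /esym xE; have : [set x | Tu x = x] x by [].
  by rewrite -T_fix/=; lra.
exists (Tu x) => // y; rewrite /= in_itv/= => /andP[xy yT].
split; first exact: le_trans xy.
have [->//|xy'] := eqVneq y x.
have lt_xy : x < y by rewrite lt_neqAle eq_sym xy'.
have /andP[Ty _] := T_le y.
rewrite ltNge; apply/negP => cT; apply: (T_left lt_xy).
by apply/andP; split; lra.
Qed.

Section path.
Variable beta : R -> R.
Hypothesis cb : {within `[0, +oo[, continuous beta}.

Definition gap t : R := Num.max (Td (beta 0) - beta t) (beta t - Tu (beta 0)).

Lemma gap_ge0 t : 0 <= gap t <-> beta t <= Td (beta 0) \/ Tu (beta 0) <= beta t.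
Proof. by rewrite /gap le_max !subr_ge0; split=> /orP. Qed.

Lemma gap_gt0 t : 0 < gap t <-> beta t < Td (beta 0) \/ Tu (beta 0) < beta t.
Proof. by rewrite /gap lt_max !subr_gt0; split=> /orP. Qed.

(** A barrier point reached at time [t] is a value [T_i x'] with
[beta 0 <= x']. The order conditions on the maps keep such values out of the open
interval of [beta 0]. *)
Lemma barrier_gap t : barrier Td Tu (beta t - beta 0, beta t) -> 0 <= gap t.
Proof.
rewrite gap_ge0 => -[] [x _ [/=]]; rewrite in_itv/= andbT => le_x bt.
  right; rewrite bt; apply: Tu_mono; rewrite bt in le_x; lra.
have : beta 0 <= x by rewrite bt in le_x; lra.
rewrite le_eqVlt => /orP[/eqP->|lt_x]; first by left; rewrite bt.
have [|lt1] := leP (beta t) (Td (beta 0)); [by left|right].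
by rewrite leNgt; apply/negP => lt2; apply: (T_left lt_x); rewrite -bt lt1.
Qed.

(** On its way out, the path takes the value [Td (beta 0)] or [Tu (beta 0)],
which is a barrier point. *)
Lemma gap_barrier (t : R) : 0 <= t -> 0 <= gap t ->
  exists2 s, 0 <= s <= t & barrier Td Tu (beta s - beta 0, beta s).
Proof.
move=> t0 /gap_ge0 gt; have /andP[Td0 Tu0] := T_le (beta 0).
have bar (T : R -> R) s : beta s = T (beta 0) -> map_barrier T (beta s - beta 0, beta s).
  by move=> E; exists (beta 0) => //; split=> //=; rewrite in_itv/= andbT E.
have cbt : {within `[0, t], continuous beta} by apply: path_itv_continuous cb _ _ _.
case: gt => [bt|bt].
  have h : Num.min (beta 0) (beta t) <= Td (beta 0) <= Num.max (beta 0) (beta t).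
    by rewrite ge_min le_max bt Td0 orbT.
  have [s] := IVT t0 cbt h; rewrite in_itv/= => st sE.
  by exists s => //; right; exact: bar.
have h : Num.min (beta 0) (beta t) <= Tu (beta 0) <= Num.max (beta 0) (beta t).
  by rewrite ge_min le_max bt Tu0 orbT.
have [s] := IVT t0 cbt h; rewrite in_itv/= => st sE.
by exists s => //; left; exact: bar.
Qed.

(** Barrier times are times outside the open interval, and each of the latter is
preceded by a barrier time: the two sets have the same infimum. *)
Lemma barrier_time_gap :
  first_time [set t | 0 <= t /\ barrier Td Tu (beta t - beta 0, beta t)] =
  first_time (closed_hits gap).
Proof.
apply/eqP; rewrite eq_le; apply/andP; split; apply: first_time_ge => t [t0 Ht].
  have [s /andP[s0 st] Hs] := gap_barrier t0 Ht.
  by apply: le_trans (first_time_le (_ : _ s)) _ => //; rewrite lee_fin.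
by apply: first_time_le; split=> //; exact: barrier_gap.
Qed.

Lemma exit_time_gap :
  first_time [set t | 0 < t /\ ~ (`[Td (beta 0), Tu (beta 0)]%classic (beta t))] =
  first_time (open_hits gap).
Proof.
congr first_time; apply/seteqP; split=> t /= [t0 Ht].
  split; first exact: ltW.
  apply/gap_gt0; move: Ht; rewrite in_itv/= => /negP; rewrite negb_and -!ltNge.
  by move=> /orP[]; [left|right].
have Ht' : ~ beta t \in `[Td (beta 0), Tu (beta 0)].
  by rewrite in_itv/= => /andP[h1 h2]; move/gap_gt0: Ht => []; lra.
split=> //; rewrite lt_neqAle t0 andbT; apply/eqP => t0E; apply: Ht'.
by rewrite -t0E in_itv/=; exact: T_le.
Qed.

End path.
End maps.

(** * Touching and crossing the boundary of an interval: paths *)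

Section stay.
Context (R : realType) (beta : R -> R).
Hypothesis cb : {within `[0, +oo[, continuous beta}.

Lemma stay_closed lo hi r : 0 <= r -> lo <= beta 0 <= hi ->
  (forall s, 0 <= s -> s < r -> lo <= beta s <= hi) -> lo <= beta r <= hi.
Proof.
move=> r0 b0 H; have [<-//|r_neq0] := eqVneq 0 r.
have r_gt0 : 0 < r by rewrite lt_neqAle r_neq0.
have near_left e : 0 < e -> exists2 s, lo <= beta s <= hi & `|beta s - beta r| < e.
  move=> e0; have [z z0 Hz] := path_continuous cb r0 e0.
  pose s := Num.max 0 (r - z / 2).
  have s0 : 0 <= s by rewrite le_max lexx.
  have sr : s < r by rewrite gt_max r_gt0/=; lra.
  exists s; first exact: H.
  apply: Hz => //; rewrite ltr0_norm ?subr_lt0// opprB ltrBlDl -ltrBlDr lt_max.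
  by apply/orP; right; lra.
apply/andP; split; rewrite leNgt; apply/negP => lt_b.
  have [s /andP[h1 h2]] := near_left (lo - beta r) ltac:(lra).
  by rewrite ltr_distl => /andP[]; lra.
have [s /andP[h1 h2]] := near_left (beta r - hi) ltac:(lra).
by rewrite ltr_distl => /andP[]; lra.
Qed.

Lemma lt_first_time (A : set R) t : (t%:E < first_time A)%E -> ~ A t.
Proof. by move=> tA At; move: tA; rewrite ltNge first_time_le. Qed.

Lemma stay_capped lo hi (sigma : \bar R) N : 0 <= N -> (0 <= sigma)%E ->
  lo <= beta 0 <= hi ->
  (forall s, 0 <= s -> (s%:E < sigma)%E -> lo <= beta s <= hi) ->
  lo <= beta (capped sigma N) <= hi.
Proof.
move=> N0 s0 b0 H; apply: stay_closed => //; first exact: capped_ge0.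
move=> s s0' sN; apply: H => //.
by apply: lt_le_trans (capped_le_time N s0); rewrite lte_fin.
Qed.

End stay.

Section crossing_path.
Context (R : realType) (y : R -> R) (lo hi : R).
Hypothesis cy : {within `[0, +oo[, continuous y}.
Hypothesis y0 : lo <= y 0 <= hi.

Local Notation low := (fun t => lo - y t).
Local Notation high := (fun t => y t - hi).
Local Notation both := (fun t => Num.max (lo - y t) (y t - hi)).

Lemma within_low : {within `[0, +oo[, continuous low}.
Proof. by move=> t; apply: cvgB; [exact: cvg_cst|exact: cy]. Qed.

Lemma within_high : {within `[0, +oo[, continuous high}.
Proof. by move=> t; apply: cvgB; [exact: cy|exact: cvg_cst]. Qed.

Lemma within_both : {within `[0, +oo[, continuous both}.
Proof.
have -> : both = (fun t => (lo - y t + (y t - hi) + `|lo - y t - (y t - hi)|) / 2).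
  by apply/funext => t; rewrite maxr_absE.
move=> t; apply: cvgM; [|exact: cvg_cst]; apply: cvgD.
  by apply: cvgD; [exact: within_low|exact: within_high].
by apply: cvg_norm; apply: cvgB; [exact: within_low|exact: within_high].
Qed.

Lemma before_both s : 0 <= s -> (s%:E < first_time (closed_hits both))%E ->
  lo < y s < hi.
Proof.
move=> s0 /lt_first_time H; apply/andP; split; rewrite ltNge; apply/negP => h;
  by apply: H; split=> //; rewrite le_max; lra.
Qed.

Lemma before_open s : 0 <= s -> (s%:E < first_time (open_hits both))%E ->
  lo <= y s <= hi.
Proof.
move=> s0 /lt_first_time H; apply/andP; split; rewrite leNgt; apply/negP => h;
  by apply: H; split=> //; rewrite lt_max; lra.
Qed.

Lemma before_half s : 0 <= s ->
  (s%:E < Order.min (first_time (closed_hits low)) (first_time (open_hits high)))%E ->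
  lo < y s <= hi.
Proof.
rewrite lt_min => s0 /andP[/lt_first_time H1 /lt_first_time H2].
apply/andP; split; [rewrite ltNge|rewrite leNgt]; apply/negP => h.
  by apply: H1; split=> //; lra.
by apply: H2; split=> //; lra.
Qed.

Lemma both_time_ge0 : (0 <= first_time (closed_hits both))%E.
Proof. by apply: first_time_ge => t [t0 _]; rewrite lee_fin. Qed.

Lemma both_capped N : 0 <= N ->
  lo <= y (capped (first_time (closed_hits both)) N) <= hi.
Proof.
move=> N0; apply: stay_capped => //; first exact: both_time_ge0.
by move=> s s0 /(before_both s0)/andP[/ltW-> /ltW->].
Qed.

Lemma both_attained r : first_time (closed_hits both) = r%:E ->
  0 <= r /\ (y r = lo \/ y r = hi).
Proof.
move=> rE; have [r0 br] := closed_hit_attained within_both rE; split=> //.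
have := both_capped r0; rewrite rE capped_fin// => /andP[h1 h2].
by move: br; rewrite le_max !subr_ge0 => /orP[]; [left|right]; apply/eqP; rewrite eq_le; lra.
Qed.

Let half_time := Order.min (first_time (closed_hits low)) (first_time (open_hits high)).

Lemma half_time_ge0 : (0 <= half_time)%E.
Proof.
by rewrite le_min; apply/andP; split; apply: first_time_ge => t [t0 _]; rewrite lee_fin.
Qed.

Lemma both_le_half : (first_time (closed_hits both) <= half_time)%E.
Proof.
rewrite le_min; apply/andP; split; apply: first_time_ge => t [t0 ht];
  by apply: first_time_le; split=> //; rewrite le_max; lra.
Qed.

Lemma half_capped N : 0 <= N -> lo <= y (capped half_time N) <= hi.
Proof.
move=> N0; apply: stay_capped => //; first exact: half_time_ge0.
by move=> s s0 /(before_half s0)/andP[/ltW-> ->].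
Qed.

(** If [lo] is touched first, the two times agree. If [hi] is touched first,
the value [hi] at that time is the largest possible one before [half_time]. *)
Lemma half_capped_le N : 0 <= N ->
  y (capped half_time N) <= y (capped (first_time (closed_hits both)) N).
Proof.
move=> N0; have [NH|] := leP N%:E (first_time (closed_hits both)).
  by rewrite !capped_ge//; exact: le_trans both_le_half.
have := both_time_ge0; case E : (first_time (closed_hits both)) => [r| |]// _.
rewrite lte_fin => /ltW rN; have [r0 [yr|yr]] := both_attained E; last first.
  by rewrite (capped_fin rN) yr; have /andP[] := half_capped N0.
suff -> : half_time = r%:E by rewrite capped_fin.
apply/eqP; rewrite eq_le -{2}E both_le_half andbT ge_min.
by apply/orP; left; apply: first_time_le; split=> //; lra.
Qed.

End crossing_path.

(** * Touching and crossing the boundary of an interval: means *)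

Section ae_tools.
Context d (T : measurableType d) (R : realType) (P : probability T R).

Lemma ae_eq0_of_Rintegral0 (f : T -> R) : P.-integrable setT (EFin \o f) ->
  {ae P, forall w, 0 <= f w} -> \int[P]_w f w = 0 -> {ae P, forall w, f w = 0}.
Proof.
move=> i_f f0 f_int.
have mf : measurable_fun setT (EFin \o f) by exact: measurable_int i_f.
have : ae_eq P setT (EFin \o f) (cst 0%E).
  apply/(ae_eq_integral_abs P measurableT mf).
  rewrite (_ : (\int[P]_w `|(EFin \o f) w| = \int[P]_w (EFin \o f) w)%E).
    by rewrite -[LHS]fineK ?integrable_fin_num//; congr EFin.
  apply: ae_eq_integral => //; first exact: measurableT_comp.
  by apply: filterS f0 => w fw _; rewrite /= ger0_norm.
by apply: filterS => w /(_ I)[].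
Qed.

Lemma ae_forall_rat (Q : rat -> T -> Prop) : (forall q, {ae P, forall w, Q q w}) ->
  {ae P, forall w q, Q q w}.
Proof.
move=> HQ.
have : {ae P, forall w n, if unpickle n is Some q then Q q w else True}.
  apply: ae_foralln => n; case: (unpickle n) => [q|]; first exact: HQ.
  by apply: aeW.
by apply: filterS => w H q; have := H (pickle q); rewrite pickleK.
Qed.

End ae_tools.

Section crossing.
Context d (Omega : measurableType d) (R : realType) (P : probability Omega R).
Variables (F : R -> set (set Omega)).
Hypotheses (F_filtration : filtration F) (F_usual : usual_conditions P F).
Variables (Y : R -> Omega -> R) (lo hi : Omega -> R).
Hypothesis aY : forall t, 0 <= t -> adapted_at F t (Y t).
Hypothesis cY : {ae P, forall w, {within `[0, +oo[, continuous (Y ^~ w)}}.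
Hypotheses (alo : adapted_at F 0 lo) (ahi : adapted_at F 0 hi).
Hypothesis Y0 : forall w, lo w <= Y 0 w <= hi w.
Hypothesis Y_stopping : forall (sigma : Omega -> \bar R) (N K : R) (h : Omega -> R),
  stopping_time F sigma -> 0 < N -> adapted_at F 0 h ->
  {ae P, forall w, `|h w * (Y (capped (sigma w) N) w - Y 0 w)| <= K} ->
  P.-integrable setT (EFin \o (fun w => h w * (Y (capped (sigma w) N) w - Y 0 w))) /\
  \int[P]_w (h w * (Y (capped (sigma w) N) w - Y 0 w)) = 0.

Definition low_gap t w := lo w - Y t w.
Definition high_gap t w := Y t w - hi w.
Definition both_gap t w := Num.max (low_gap t w) (high_gap t w).
(** Here [lo] still stops the process when it is touched, but [hi] only when it is
exceeded. *)
Definition half_time w := Order.min (closed_hit low_gap w) (open_hit high_gap w).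

Let a_init t (f : Omega -> R) : 0 <= t -> adapted_at F 0 f -> adapted_at F t f.
Proof. by move=> t0; exact: (adapted_at_le F_filtration (lexx 0)). Qed.

Let a_low t : 0 <= t -> adapted_at F t (low_gap t).
Proof. by move=> t0; apply: measurable_funB; [exact: a_init|exact: aY]. Qed.

Let a_high t : 0 <= t -> adapted_at F t (high_gap t).
Proof. by move=> t0; apply: measurable_funB; [exact: aY|exact: a_init]. Qed.

Let a_both t : 0 <= t -> adapted_at F t (both_gap t).
Proof. by move=> t0; apply: measurable_maxr; [exact: a_low|exact: a_high]. Qed.

Lemma both_hit_stopping : stopping_time F (closed_hit both_gap).
Proof.
apply: (closed_hit_stopping F_filtration F_usual a_both).
by apply: filterS cY => w; exact: within_both.
Qed.

Lemma both_exit_stopping : stopping_time F (open_hit both_gap).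
Proof.
apply: (open_hit_stopping F_filtration F_usual a_both).
by apply: filterS cY => w; exact: within_both.
Qed.

Lemma half_time_stopping : stopping_time F half_time.
Proof.
apply: (stopping_time_min F_filtration).
  apply: (closed_hit_stopping F_filtration F_usual a_low).
  by apply: filterS cY => w; exact: within_low.
apply: (open_hit_stopping F_filtration F_usual a_high).
by apply: filterS cY => w; exact: within_high.
Qed.

(** The weight is 0 on degenerate intervals, where the process has nowhere to
go. *)
Definition inv_width w := if lo w < hi w then (hi w - lo w)^-1 else 0.

Lemma inv_width_adapted : adapted_at F 0 inv_width.
Proof.
have -> : inv_width = (fun w => if lo w < hi w then (hi w - lo w) `^ (-1) else 0).
  apply/funext => w; rewrite /inv_width; case: ifPn => // lohi.
  by rewrite powR_inv1// subr_ge0 ltW.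
apply: measurable_fun_ifT; [exact: measurable_fun_ltr| |exact: measurable_cst].
apply: (@measurableT_comp _ _ _ _ _ _ (@powR R ^~ (-1))); first exact: measurable_powR.
exact: measurable_funB.
Qed.

Lemma inv_width_bound w y : lo w <= y <= hi w ->
  `|inv_width w * (y - Y 0 w)| <= 1.
Proof.
have /andP[h1 h2] := Y0 w; move=> /andP[h3 h4]; rewrite /inv_width.
case: ifPn => [lohi|_]; last by rewrite mul0r normr0.
rewrite normrM gtr0_norm ?invr_gt0 ?subr_gt0// mulrC ler_pdivrMr ?subr_gt0//.
by rewrite mul1r ler_norml; lra.
Qed.

(** One stopped value dominates the other, and both have mean [Y 0] given the
initial information: so they are equal. *)
Lemma half_time_value q : 0 < q -> {ae P, forall w, lo w < hi w ->
  Y (capped (half_time w) q) w = Y (capped (closed_hit both_gap w) q) w}.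
Proof.
move=> q0.
have [|i1 e1] := Y_stopping both_hit_stopping q0 inv_width_adapted (K := 1).
  apply: filterS cY => w cw; apply: inv_width_bound.
  exact: (@both_capped R (Y ^~ w) (lo w) (hi w) cw (Y0 w) q (ltW q0)).
have [|i2 e2] := Y_stopping half_time_stopping q0 inv_width_adapted (K := 1).
  apply: filterS cY => w cw; apply: inv_width_bound.
  exact: (@half_capped R (Y ^~ w) (lo w) (hi w) cw (Y0 w) q (ltW q0)).
pose D w := inv_width w * (Y (capped (closed_hit both_gap w) q) w - Y 0 w) -
  inv_width w * (Y (capped (half_time w) q) w - Y 0 w).
have iD : P.-integrable setT (EFin \o D) by have := integrableB measurableT i1 i2.
have D0 : {ae P, forall w, 0 <= D w}.
  apply: filterS cY => w cw; rewrite /D -mulrBr /inv_width.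
  case: ifPn => [lohi|_]; last by rewrite mul0r.
  apply: mulr_ge0; first by rewrite invr_ge0 subr_ge0 ltW.
  rewrite subr_ge0 lerD2r.
  exact: (@half_capped_le R (Y ^~ w) (lo w) (hi w) cw (Y0 w) q (ltW q0)).
have := ae_eq0_of_Rintegral0 iD D0; rewrite RintegralB// e1 e2 subr0 => /(_ erefl).
apply: filterS => w; rewrite /D -mulrBr /inv_width => /eqP + lohi.
rewrite lohi mulf_eq0 invr_eq0 subr_eq0 gt_eqF//= => /eqP; lra.
Qed.

End crossing.

(** * The first touching time is the exit time *)

Section exit_path.
Context (R : realType) (y : R -> R) (lo hi : R).
Hypothesis cy : {within `[0, +oo[, continuous y}.
Hypothesis y0 : lo <= y 0 <= hi.
Hypothesis not_flat : forall p q : rat, 0 <= ratr p :> R -> ratr p < ratr q :> R ->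
  y (ratr p) != y (ratr q).

Local Notation both := (fun t => Num.max (lo - y t) (y t - hi)).
Local Notation upper_half := (Order.min (first_time (closed_hits (fun t => lo - y t)))
  (first_time (open_hits (fun t => y t - hi)))).
Local Notation lower_half := (Order.min (first_time (closed_hits (fun t => - hi - - y t)))
  (first_time (open_hits (fun t => - y t - - lo)))).

Hypothesis upperP : lo < hi -> forall q : rat, 0 < ratr q :> R ->
  y (capped upper_half (ratr q)) = y (capped (first_time (closed_hits both)) (ratr q)).
Hypothesis lowerP : lo < hi -> forall q : rat, 0 < ratr q :> R ->
  y (capped lower_half (ratr q)) = y (capped (first_time (closed_hits both)) (ratr q)).

Let no_flat_after (r : R) (x : \bar R) : 0 <= r -> (r%:E < x)%E ->
  (forall q : rat, r < ratr q -> ((ratr q)%:E < x)%E -> y (ratr q) = y r) -> False.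
Proof.
move=> r0 rx H.
have [s rs sx] : exists2 s : R, r < s & (s%:E <= x)%E.
  case: x rx {H} => [z| |]//; last by move=> _; exists (r + 1); [lra|rewrite leey].
  by rewrite lte_fin => rz; exists z.
have /rat_in_itvoo[p] := rs; rewrite in_itv/= => /andP[rp ps].
have /rat_in_itvoo[q] := ps; rewrite in_itv/= => /andP[pq qs].
have below z : z < s -> (z%:E < x)%E by move=> zs; apply: lt_le_trans sx; rewrite lte_fin.
have := not_flat (ltW (le_lt_trans r0 rp)) pq.
by rewrite (H p) ?(H q) ?eqxx//; [exact: lt_trans pq|exact: below|exact: below].
Qed.

(** If the path touched an endpoint and remained in the closed interval for a
while, then the hypothesis for that endpoint would make it constant during that
time. On a degenerate interval it is constant in any case. *)
Lemma hit_eq_exit : first_time (closed_hits both) = first_time (open_hits both).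
Proof.
apply/eqP; rewrite eq_le; apply/andP; split.
  by apply: first_time_ge => t [t0 /ltW bt]; apply: first_time_le.
rewrite leNgt; apply/negP => hit_lt.
have [r rE] : exists r, first_time (closed_hits both) = r%:E.
  have := both_time_ge0 y lo hi.
  by case: first_time hit_lt => // [r _ _|]; [exists r|rewrite ltNge leey].
have [r0 yr] := both_attained cy y0 rE.
rewrite rE in hit_lt.
have lohi_le : lo <= hi by case/andP: y0; exact: le_trans.
have below_exit s : 0 <= s -> (s%:E < first_time (open_hits both))%E -> lo <= y s <= hi.
  exact: before_open.
have [lohi|hilo] := ltP lo hi; last first.
  have E : lo = hi by apply/eqP; rewrite eq_le lohi_le hilo.
  apply: (no_flat_after r0 hit_lt) => q rq qx.
  have /andP[h1 h2] := below_exit _ (ltW (le_lt_trans r0 rq)) qx.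
  by case: yr => ->; lra.
have capped_r (q : rat) : r < ratr q -> capped (first_time (closed_hits both)) (ratr q) = r.
  by move=> rq; rewrite rE capped_fin// ltW.
case: yr => yr.
- have r_lt : (r%:E < lower_half)%E.
    rewrite lt_min; apply/andP; split; last first.
      apply: lt_le_trans hit_lt _; apply: first_time_ge => t [t0 ht].
      by apply: first_time_le; split=> //; rewrite lt_max; lra.
    rewrite lt_neqAle; apply/andP; split; last first.
      rewrite -rE; apply: first_time_ge => t [t0 ht].
      by apply: first_time_le; split=> //; rewrite le_max; lra.
    apply/eqP => /esym E; have cNy : {within `[0, +oo[, continuous (fun t => - y t)}.
      by move=> t; apply: cvgN; exact: cy.
    by have [_] := closed_hit_attained (@within_low R (fun t => - y t) (- hi) cNy) E; lra.
  apply: (no_flat_after r0 r_lt) => q rq qx.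
  have := lowerP lohi (le_lt_trans r0 rq); rewrite capped_r// => <-.
  by rewrite capped_ge// ltW.
- have r_lt : (r%:E < upper_half)%E.
    rewrite lt_min; apply/andP; split; last first.
      apply: lt_le_trans hit_lt _; apply: first_time_ge => t [t0 ht].
      by apply: first_time_le; split=> //; rewrite lt_max; lra.
    rewrite lt_neqAle; apply/andP; split; last first.
      rewrite -rE; apply: first_time_ge => t [t0 ht].
      by apply: first_time_le; split=> //; rewrite le_max; lra.
    apply/eqP => /esym E.
    by have [_] := closed_hit_attained (@within_low R y lo cy) E; lra.
  apply: (no_flat_after r0 r_lt) => q rq qx.
  have := upperP lohi (le_lt_trans r0 rq); rewrite capped_r// => <-.
  by rewrite capped_ge// ltW.
Qed.

End exit_path.

Section brownian_exit.
Context d (Omega : measurableType d) (R : realType) (P : probability Omega R).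
Variables (mu : probability R R) (F : R -> set (set Omega)) (B : R -> Omega -> R).
Hypotheses (F_filtration : filtration F) (F_usual : usual_conditions P F).
Hypothesis B_brownian : brownian_motion P F mu B.
Variables lo hi : Omega -> R.
Hypotheses (alo : adapted_at F 0 lo) (ahi : adapted_at F 0 hi).
Hypothesis B0 : forall w, lo w <= B 0 w <= hi w.

Definition hit_time := closed_hit (both_gap B lo hi).
Definition exit_time := open_hit (both_gap B lo hi).

Let cB := B_continuous B_brownian.
Let aB t (t0 : 0 <= t) := B_adapted F_filtration B_brownian t0.

Lemma hit_time_stopping : stopping_time F hit_time.
Proof. exact: (both_hit_stopping F_filtration F_usual aB cB alo ahi). Qed.

Lemma exit_time_stopping : stopping_time F exit_time.
Proof. exact: (both_exit_stopping F_filtration F_usual aB cB alo ahi). Qed.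

Lemma hit_time_capped : {ae P, forall w, forall N, 0 < N ->
  lo w <= B (capped (hit_time w) N) w <= hi w}.
Proof.
apply: filterS cB => w cw N N0.
exact: (@both_capped R (B ^~ w) (lo w) (hi w) cw (B0 w) N (ltW N0)).
Qed.

Lemma ae_not_flat : {ae P, forall w, forall p q : rat, 0 <= ratr p :> R ->
  ratr p < ratr q :> R -> B (ratr p) w != B (ratr q) w}.
Proof.
apply: ae_forall_rat => p; apply: ae_forall_rat => q.
have [p0|p0] := boolP (0 <= ratr p :> R); last by apply: aeW => w.
have [pq|pq] := boolP (ratr p < ratr q :> R); last by apply: aeW => w.
have H := incr_neq0 B_brownian p0 pq; by apply: filterS H => w.
Qed.

Let B_stopping (sigma : Omega -> \bar R) (N K : R) (h : Omega -> R) :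
  stopping_time F sigma -> 0 < N -> adapted_at F 0 h ->
  {ae P, forall w, `|h w * (B (capped (sigma w) N) w - B 0 w)| <= K} ->
  P.-integrable setT (EFin \o (fun w => h w * (B (capped (sigma w) N) w - B 0 w))) /\
  \int[P]_w (h w * (B (capped (sigma w) N) w - B 0 w)) = 0.
Proof.
move=> sigmaS N0 ah hK.
exact: (optional_stopping_horizon F_filtration F_usual B_brownian sigmaS N0 ah hK).
Qed.

Let NB_stopping (sigma : Omega -> \bar R) (N K : R) (h : Omega -> R) :
  stopping_time F sigma -> 0 < N -> adapted_at F 0 h ->
  {ae P, forall w, `|h w * (- B (capped (sigma w) N) w - - B 0 w)| <= K} ->
  P.-integrable setT (EFin \o (fun w => h w * (- B (capped (sigma w) N) w - - B 0 w))) /\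
  \int[P]_w (h w * (- B (capped (sigma w) N) w - - B 0 w)) = 0.
Proof.
move=> sigmaS N0 ah.
have -> : (fun w => h w * (- B (capped (sigma w) N) w - - B 0 w)) =
    (fun w => - h w * (B (capped (sigma w) N) w - B 0 w)).
  by apply/funext => w; ring.
have E w : `|h w * (- B (capped (sigma w) N) w - - B 0 w)| =
    `|- h w * (B (capped (sigma w) N) w - B 0 w)|.
  by congr (`|_|); ring.
move=> hK; apply: B_stopping => //; first exact: measurable_funN.
by apply: filterS hK => w; rewrite E; exact.
Qed.

Let both_gapN : both_gap (fun t w => - B t w) (fun w => - hi w) (fun w => - lo w) =
  both_gap B lo hi.
Proof.
apply/funext => t; apply/funext => w; rewrite /both_gap /low_gap /high_gap maxC.
by congr (Num.max _ _); ring.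
Qed.

Lemma hit_time_exit_time : {ae P, forall w, hit_time w = exit_time w}.
Proof.
have up : {ae P, forall w, forall q : rat, 0 < ratr q :> R -> lo w < hi w ->
    B (capped (half_time B lo hi w) (ratr q)) w = B (capped (hit_time w) (ratr q)) w}.
  apply: ae_forall_rat => q; have [q0|q0] := boolP (0 < ratr q :> R); last by apply: aeW => w.
  have := half_time_value F_filtration F_usual aB cB alo ahi B0 B_stopping q0.
  by apply: filterS => w H _; exact: H.
have down : {ae P, forall w, forall q : rat, 0 < ratr q :> R -> lo w < hi w ->
    B (capped (half_time (fun t w => - B t w) (fun w => - hi w) (fun w => - lo w) w)
      (ratr q)) w = B (capped (hit_time w) (ratr q)) w}.
  apply: ae_forall_rat => q; have [q0|q0] := boolP (0 < ratr q :> R); last by apply: aeW => w.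
  have aNB t (t0 : 0 <= t) : adapted_at F t (fun w => - B t w).
    by apply: measurable_funN; exact: aB.
  have cNB : {ae P, forall w, {within `[0, +oo[, continuous (fun t => - B t w)}}.
    by apply: filterS cB => w cw t; apply: cvgN; exact: cw.
  have NB0 w : - hi w <= - B 0 w <= - lo w by have := B0 w; rewrite !lerN2 andbC.
  have := half_time_value F_filtration F_usual aNB cNB (measurable_funN ahi)
    (measurable_funN alo) NB0 NB_stopping q0.
  apply: filterS => w H _ lohi; rewrite /hit_time -both_gapN.
  by apply: oppr_inj; apply: H; rewrite ltrN2.
have cflat : {ae P, forall w, {within `[0, +oo[, continuous (B ^~ w)} /\
    forall p q : rat, 0 <= ratr p :> R -> ratr p < ratr q :> R ->
    B (ratr p) w != B (ratr q) w}.
  by apply: filterS2 cB ae_not_flat => w.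
apply: filterS3 cflat up down => w [cw flat] upw downw.
by apply: (@hit_eq_exit R (B ^~ w) (lo w) (hi w) cw (B0 w) flat) => lohi q q0;
  [exact: upw|exact: downw].
Qed.

(** On the event that the interval has width at most [k] and is never left, all
increments from 0 are at most [k]; their standard deviations are unbounded. *)
Lemma hit_time_fin : {ae P, forall w, (hit_time w < +oo)%E}.
Proof.
suff : forall k : nat, {ae P, forall w, hi w - lo w <= k%:R -> (hit_time w < +oo)%E}.
  move=> /ae_foralln; apply: filterS => w H.
  apply: (H (Num.bound (hi w - lo w))).
  apply/ltW/archi_boundP; have /andP[h1 h2] := B0 w; lra.
move=> k.
(* squares of integers as times, so that the standard deviations are integers *)
pose C := \bigcap_(n : nat) [set w | `|incr B 0 (n.+1%:R ^+ 2) w| <= k%:R].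
have m2 (n : nat) : 0 < n.+1%:R ^+ 2 :> R by rewrite exprn_gt0.
have mC1 n : measurable [set w | `|incr B 0 (n.+1%:R ^+ 2) w| <= k%:R].
  have [mW _] := incr_law B_brownian (lexx 0) (m2 n).
  have -> : [set w | `|incr B 0 (n.+1%:R ^+ 2) w| <= k%:R] =
      incr B 0 (n.+1%:R ^+ 2) @^-1` `[- k%:R, k%:R]%classic.
    by apply/seteqP; split=> w /=; rewrite in_itv/= ler_norml.
  by rewrite -[X in measurable X]setTI; apply: mW => //; exact: measurable_itv.
have mC : measurable C by apply: bigcapT_measurable.
apply: filterS2 cB (_ : {ae P, forall w, ~ C w}) => [w cw nC wk|]; last first.
  exists C; split=> //; last by move=> w /= /contrapT.
  apply/eqP; rewrite eq_le measure_ge0 andbT.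
  apply/lee_addgt0Pr => e e0; rewrite add0e.
  pose n := Num.bound (2 * k%:R / e).
  have [mW hW] := incr_law B_brownian (lexx 0) (m2 n).
  apply: (@le_trans _ _ (P [set w | `|incr B 0 (n.+1%:R ^+ 2) w| <= k%:R])).
    by apply: le_measure; rewrite ?inE// => w; apply.
  have := hW [set x | `|x| <= k%:R].
  rewrite /pushforward /= => ->; last first.
    have -> : [set x : R | `|x| <= k%:R] = `[- k%:R, k%:R]%classic.
      by apply/seteqP; split=> x /=; rewrite in_itv/= ler_norml.
    exact: measurable_itv.
  apply: le_trans (normal_prob_ball (sqrt_neq0 (m2 n)) (ler0n R k)) _.
  rewrite lee_fin subr0 sqrtr_sqr ger0_norm//.
  apply: (@le_trans _ _ (2 * k%:R / n.+1%:R)).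
    apply: ler_wpM2l; first by rewrite mulr_ge0.
    rewrite /normal_peak lef_pV2 ?posrE// ?sqrtr_gt0 ?mulrn_wgt0 ?mulr_gt0 ?pi_gt0//.
    rewrite -[leLHS](ger0_norm (ler0n R n.+1)) -sqrtr_sqr ler_wsqrtr//.
    by have := pi_ge2 R; have := ltW (m2 n); set u := n.+1%:R ^+ 2; rewrite -mulr_natr; nra.
  rewrite ler_pdivrMr// [leRHS]mulrC -ler_pdivrMr//.
  apply: (@le_trans _ _ n%:R); last by rewrite ler_nat.
  by apply/ltW/archi_boundP; rewrite divr_ge0 ?mulr_ge0// ltW.
rewrite ltey; apply/eqP => hy; apply: nC => n _ /=.
have h0 : ((n.+1%:R ^+ 2)%:E < first_time (closed_hits
    (fun t => Num.max (lo w - B t w) (B t w - hi w))%R))%E.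
  by rewrite [X in (_ < X)%E](_ : _ = hit_time w)// hy ltry.
have /andP[h1 h2] := before_both (ltW (m2 n)) h0.
have /andP[h3 h4] := B0 w.
by rewrite /incr ler_norml; lra.
Qed.

End brownian_exit.

(** * Laws and a strictly convex function *)

Section laws.
Context d (T : measurableType d) (R : realType) (P : probability T R).

Lemma measure_ae_le (A A' : set T) : measurable A -> measurable A' ->
  {ae P, forall w, A w -> A' w} -> (P A <= P A')%E.
Proof.
move=> mA mA' [N [mN N0 subN]].
apply: (@le_trans _ _ (P (A' `|` N))).
  apply: le_measure; rewrite ?inE//; first exact: measurableU.
  move=> w Aw; have [A'w|nA'w] := pselect (A' w); [by left|right].
  by apply: subN => /= H; exact/nA'w/H.
have : (P (A' `|` N) <= P A' + P N)%E by exact: measureU2.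
by rewrite N0 adde0.
Qed.

Lemma has_law_ae d' (T' : measurableType d') (X Y : T -> T') (m : set T' -> \bar R) :
  measurable_fun setT Y -> {ae P, forall w, X w = Y w} -> has_law P X m -> has_law P Y m.
Proof.
move=> mY XY [mX hX]; split=> // A mA; rewrite -hX// /pushforward.
have mXA : measurable (X @^-1` A) by rewrite -[X in measurable X]setTI; exact: mX.
have mYA : measurable (Y @^-1` A) by rewrite -[X in measurable X]setTI; exact: mY.
by apply/eqP; rewrite eq_le; apply/andP; split; apply: measure_ae_le => //;
  apply: filterS XY => w /= ->.
Qed.

Lemma has_law_integrable d' (T' : measurableType d') (X : T -> T')
    (m : probability T' R) (f : T' -> R) :
  has_law P X m -> measurable_fun setT f -> m.-integrable setT (EFin \o f) ->
  P.-integrable setT (EFin \o (f \o X)) /\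
  \int[P]_w (f \o X) w = \int[m]_x f x.
Proof.
move=> [mX hX] mf i_f.
have i_fX : P.-integrable setT (EFin \o (f \o X)).
  apply/integrableP; split.
    by apply/measurable_EFinP; exact: measurableT_comp.
  have mf' : measurable_fun setT (fun x => `|(f x)%:E|%E).
    by apply: measurableT_comp => //; exact/measurable_EFinP.
  move/integrableP : i_f => [_]; apply: le_lt_trans; rewrite le_eqVlt; apply/orP; left.
  apply/eqP; rewrite -[LHS](@ge0_integral_pushforward _ _ _ _ R _ mX P setT
    (fun x => `|(f x)%:E|%E))//.
  by apply: eq_measure_integral => A mA _; exact: hX.
split=> //; rewrite /Rintegral; congr fine.
have mEf : measurable_fun setT (EFin \o f) by exact/measurable_EFinP.
rewrite -[LHS](@integral_pushforward _ _ _ _ R _ mX P setT (EFin \o f))//.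
by apply: eq_measure_integral => A mA _; exact: hX.
Qed.

End laws.

Section convex_gauge.
Context (R : realType).
Implicit Types x y z : R.

(** Any strictly convex function of linear growth would do; this one is
1-Lipschitz, so that the slopes of its chords are bounded weights. *)
Definition gauge x : R := Num.sqrt (1 + x ^+ 2).

Lemma gauge_sqr x : gauge x ^+ 2 = 1 + x ^+ 2.
Proof. by rewrite sqr_sqrtr// addr_ge0// sqr_ge0. Qed.

Lemma gauge_gt0 x : 0 < gauge x.
Proof. by rewrite sqrtr_gt0 ltr_pwDl// sqr_ge0. Qed.

Lemma gauge_norm x : `|x| <= gauge x.
Proof. by rewrite -sqrtr_sqr ler_wsqrtr// lerDr. Qed.

Lemma gauge_le x : gauge x <= 1 + `|x|.
Proof.
have := gauge_sqr x; have := gauge_gt0 x; rewrite -[x ^+ 2]real_normK ?num_real//.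
by have := normr_ge0 x; set u := `|x|; set v := gauge x; nra.
Qed.

Lemma gauge_lipschitz x y : `|gauge x - gauge y| <= `|x - y|.
Proof.
have gx := gauge_gt0 x; have gy := gauge_gt0 y.
have sum0 : 0 < gauge x + gauge y by lra.
rewrite -(ler_pM2r sum0) -{1}(gtr0_norm sum0) -normrM.
have -> : (gauge x - gauge y) * (gauge x + gauge y) = (x - y) * (x + y).
  rewrite [LHS](_ : _ = gauge x ^+ 2 - gauge y ^+ 2); last by ring.
  by rewrite !gauge_sqr; ring.
rewrite normrM ler_wpM2l//; apply: le_trans (ler_normD _ _) _.
by apply: lerD; exact: gauge_norm.
Qed.

(** Strict convexity, without division. Both sides being positive, it suffices to
compare squares, whose difference factors through the Cauchy-Schwarz inequality
for (1, x) and (1, z). *)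
Lemma gauge_chord x y z : x < y -> y < z ->
  gauge y * (z - x) < gauge x * (z - y) + gauge z * (y - x).
Proof.
move=> xy yz.
have gx := gauge_gt0 x; have gy := gauge_gt0 y; have gz := gauge_gt0 z.
have sx := gauge_sqr x; have sy := gauge_sqr y; have sz := gauge_sqr z.
have cross : 1 + x * z < gauge x * gauge z.
  have [neg|pos] := ltP (1 + x * z) 0; first by apply: lt_trans neg _; exact: mulr_gt0.
  rewrite -(ltr_pXn2r (n := 2))// ?nnegrE//; last by rewrite mulr_ge0// ltW.
  rewrite exprMn sx sz -subr_gt0.
  have -> : (1 + x ^+ 2) * (1 + z ^+ 2) - (1 + x * z) ^+ 2 = (z - x) ^+ 2 by ring.
  by rewrite exprn_gt0// subr_gt0; exact: lt_trans yz.
have u0 : 0 < z - y by lra.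
have v0 : 0 < y - x by lra.
rewrite -(ltr_pXn2r (n := 2))// ?nnegrE; last 2 first.
  by rewrite mulr_ge0//; lra.
  by rewrite addr_ge0// mulr_ge0//; lra.
rewrite -subr_gt0.
have -> : (gauge x * (z - y) + gauge z * (y - x)) ^+ 2 - (gauge y * (z - x)) ^+ 2 =
    2 * ((z - y) * (y - x)) * (gauge x * gauge z - (1 + x * z)).
  rewrite [(gauge y * _) ^+ 2]exprMn sy.
  rewrite [LHS](_ : _ = gauge x ^+ 2 * (z - y) ^+ 2 + gauge z ^+ 2 * (y - x) ^+ 2 +
    2 * ((z - y) * (y - x)) * (gauge x * gauge z) - (1 + y ^+ 2) * (z - x) ^+ 2); last by ring.
  by rewrite sx sz; ring.
by rewrite !mulr_gt0// subr_gt0.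
Qed.

Lemma measurable_gauge : measurable_fun setT gauge.
Proof.
apply: continuous_measurable_fun => x; rewrite /gauge.
apply: (@continuous_comp _ _ _ (fun x : R => 1 + x ^+ 2) Num.sqrt).
  by apply: cvgD; [exact: cvg_cst|exact: exprn_continuous].
exact: sqrt_continuous.
Qed.

End convex_gauge.

(** * Exit distribution and minimality *)

Section embedding.
Context d (Omega : measurableType d) (R : realType) (P : probability Omega R).
Variables (mu : probability R R) (F : R -> set (set Omega)) (B : R -> Omega -> R).
Hypotheses (F_filtration : filtration F) (F_usual : usual_conditions P F).
Hypothesis B_brownian : brownian_motion P F mu B.
Variables lo hi : Omega -> R.
Hypotheses (alo : adapted_at F 0 lo) (ahi : adapted_at F 0 hi).
Hypothesis B0 : forall w, lo w <= B 0 w <= hi w.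

Let tau := hit_time B lo hi.
Let tauS : stopping_time F tau.
Proof. exact: (hit_time_stopping F_filtration F_usual B_brownian alo ahi). Qed.

Lemma hit_time_value : {ae P, forall w, stopped B tau w = lo w \/ stopped B tau w = hi w}.
Proof.
have fin := hit_time_fin B_brownian B0.
apply: filterS2 (B_continuous B_brownian) fin => w cw fw.
have E : first_time (closed_hits (fun t => Num.max (lo w - B t w) (B t w - hi w))) =
    (fine (tau w))%:E.
  have [tau0 _] := tauS.
  by apply/esym; apply: (@fineK _ (tau w)); rewrite ge0_fin_numE.
by have [] := @both_attained R (B ^~ w) (lo w) (hi w) cw (B0 w) _ E.
Qed.

(** The probability, given the starting point, of leaving through [hi]. *)
Definition upper_weight w := inv_width lo hi w * (B 0 w - lo w).

(** Optional stopping applied to the left-hand side identifies the conditional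
probability of the event on the right. *)
Lemma hit_time_weight w : stopped B tau w = lo w \/ stopped B tau w = hi w ->
  inv_width lo hi w * (stopped B tau w - B 0 w) =
  ((lo w < hi w) && (stopped B tau w == hi w))%:R - upper_weight w.
Proof.
rewrite /upper_weight /inv_width; case: ifPn => [lohi|_] H; last first.
  by rewrite !mul0r subr0.
have d0 : hi w - lo w != 0 by rewrite subr_eq0 gt_eqF.
case: H => ->.
  by rewrite lt_eqF//=; field.
by rewrite eqxx/=; field.
Qed.

Lemma hit_time_integral (g : Omega -> R) : adapted_at F 0 g ->
  (forall w, `|g w| <= 1) ->
  P.-integrable setT
    (EFin \o (fun w => g w * inv_width lo hi w * (stopped B tau w - B 0 w))) /\
  \int[P]_w (g w * inv_width lo hi w * (stopped B tau w - B 0 w)) = 0.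
Proof.
move=> ag g1.
have fin := hit_time_fin B_brownian B0.
apply: (optional_stopping F_filtration F_usual B_brownian tauS fin (K := 1)).
  by apply: measurable_funM => //; exact: inv_width_adapted.
apply: filterS (hit_time_capped B_brownian B0) => w H N N0.
rewrite -mulrA normrM mulr_ile1//.
by apply: (inv_width_bound B0); exact: H.
Qed.

Lemma measurable_hit_value : measurable_fun setT (stopped B tau).
Proof.
have fin := hit_time_fin B_brownian B0.
exact: (measurable_stopped F_filtration F_usual B_brownian tauS fin).
Qed.

Section minimality.
Variable nu : probability R R.
Hypothesis nu_moment : finite_first_moment nu.
Hypothesis tau_law : has_law P (stopped B tau) nu.
Variable sigma : Omega -> \bar R.
Hypothesis sigmaS : stopping_time F sigma.
Hypothesis sigma_le : {ae P, forall w, (sigma w <= tau w)%E}.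
Hypothesis sigma_fin : {ae P, forall w, (sigma w < +oo)%E}.
Hypothesis sigma_law : has_law P (stopped B sigma) nu.

Let slope w := (gauge (hi w) - gauge (lo w)) * inv_width lo hi w.

Let slope_adapted : adapted_at F 0 slope.
Proof.
apply: measurable_funM; last exact: inv_width_adapted.
by apply: measurable_funB; apply: measurableT_comp => //; exact: measurable_gauge.
Qed.

Let slope_norm w : `|slope w| <= 1.
Proof.
rewrite /slope /inv_width; case: ifPn => [lohi|_]; last by rewrite mulr0 normr0.
have d0 : 0 < hi w - lo w by rewrite subr_gt0.
have i0 : 0 <= (hi w - lo w)^-1 by rewrite invr_ge0 ltW.
rewrite normrM (ger0_norm i0) ler_pdivrMr// mul1r.
by apply: le_trans (gauge_lipschitz _ _) _; rewrite ger0_norm// ltW.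
Qed.

Let sigma_capped : {ae P, forall w, forall N, 0 < N ->
  lo w <= B (capped (sigma w) N) w <= hi w}.
Proof.
apply: filterS2 (B_continuous B_brownian) sigma_le => w cw sw N N0.
have [sigma0 _] := sigmaS.
apply: (@stay_capped R (B ^~ w) cw) => //; first exact: ltW.
move=> s s0 ss.
have st : (s%:E < first_time (closed_hits
    (fun t => Num.max (lo w - B t w) (B t w - hi w))%R))%E.
  exact: lt_le_trans ss sw.
by have /andP[/ltW-> /ltW->] := before_both s0 st.
Qed.

Let sigma_value : {ae P, forall w, lo w <= stopped B sigma w <= hi w}.
Proof.
apply: filterS2 sigma_capped sigma_fin => w H fw.
have [sigma0 _] := sigmaS.
have E : (fine (sigma w))%:E = sigma w by rewrite fineK// ge0_fin_numE.
have N0 : 0 < fine (sigma w) + 1 by rewrite ltr_pwDr// fine_ge0.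
by have := H _ N0; rewrite -E capped_fin// lerDl.
Qed.

Let i_sigma : P.-integrable setT (EFin \o stopped B sigma).
Proof. by have [] := has_law_integrable sigma_law (@measurable_id _ _ setT) nu_moment. Qed.

Let i_tau : P.-integrable setT (EFin \o stopped B tau).
Proof. by have [] := has_law_integrable tau_law (@measurable_id _ _ setT) nu_moment. Qed.

(** The slope has to be restricted to intervals of width at most [k] for the
weighted increments to be bounded; integrability of the law [nu] then lets [k]
tend to infinity. *)
Let slope_integral :
  P.-integrable setT (EFin \o (fun w => slope w * (stopped B sigma w - stopped B tau w))) /\
  \int[P]_w (slope w * (stopped B sigma w - stopped B tau w)) = 0.
Proof.
have tau_fin := hit_time_fin B_brownian B0.
pose h k w : R := (hi w - lo w <= k%:R)%R%:R * slope w.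
have ah k : adapted_at F 0 (h k).
  apply: measurable_funM => //.
  have -> : (fun w => (hi w - lo w <= k%:R)%R%:R : R) =
      \1_((fun w => hi w - lo w <= k%:R) @^-1` [set true]).
    apply/funext => w; rewrite indicE; congr ((nat_of_bool _)%:R); apply/idP/idP.
      by move=> ?; rewrite inE.
    by rewrite inE.
  apply: measurable_indic; rewrite -[X in measurable X]setTI.
  by apply: measurable_fun_ler => //; exact: measurable_funB.
have h_bound k w y : lo w <= y <= hi w -> `|h k w * (y - B 0 w)| <= k%:R.
  have /andP[h1 h2] := B0 w; move=> /andP[h3 h4]; rewrite /h.
  have [wk|_] := leP (hi w - lo w) k%:R; last by rewrite !mul0r normr0.
  rewrite mul1r normrM; apply: le_trans (_ : 1 * (hi w - lo w) <= _); last by rewrite mul1r.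
  by apply: ler_pM => //; rewrite ler_norml; lra.
have i_k k : P.-integrable setT
      (EFin \o (fun w => h k w * (stopped B sigma w - stopped B tau w))) /\
    \int[P]_w (h k w * (stopped B sigma w - stopped B tau w)) = 0.
  have [||i1 e1] := optional_stopping F_filtration F_usual B_brownian sigmaS sigma_fin
    (h := h k) (K := k%:R) => //.
    by apply: filterS sigma_capped => w H N N0; exact/h_bound/H.
  have [||i2 e2] := optional_stopping F_filtration F_usual B_brownian tauS tau_fin
    (h := h k) (K := k%:R) => //.
    by apply: filterS (hit_time_capped B_brownian B0) => w H N N0; exact/h_bound/H.
  have E w : h k w * (stopped B sigma w - stopped B tau w) =
    h k w * (stopped B sigma w - B 0 w) - h k w * (stopped B tau w - B 0 w) by ring.
  split.
    have := integrableB measurableT i1 i2; apply: eq_integrable => // w _ /=.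
    by rewrite E.
  under eq_Rintegral do rewrite E.
  by rewrite RintegralB// e1 e2 subr0.
have i_abs : P.-integrable setT
    (EFin \o (fun w => `|stopped B sigma w| + `|stopped B tau w|)).
  by have := integrableD measurableT (integrable_norm i_sigma) (integrable_norm i_tau).
have [|||iS cS] := @dominated_Rintegral _ _ _ P (usual_complete F_filtration F_usual)
  (fun k w => h k w * (stopped B sigma w - stopped B tau w))
  (fun w => slope w * (stopped B sigma w - stopped B tau w)) _ _ i_abs.
- by move=> k; apply/measurable_EFinP; have [/measurable_int] := i_k k.
- apply: aeW => w k; rewrite normrM; apply: le_trans (ler_normB _ _).
  rewrite ler_piMl// /h; have [_|_] := leP (hi w - lo w) k%:R.
    by rewrite mul1r.
  by rewrite mul0r normr0.
- apply: aeW => w; apply: cvgM; last exact: cvg_cst.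
  apply: cvg_near_cst; near=> k; rewrite /h (_ : (_ <= _)%R = true) ?mul1r//.
  by near: k; exact: nbhs_infty_ger.
split=> //; move: cS.
have -> : (fun k => \int[P]_w (h k w * (stopped B sigma w - stopped B tau w))) = cst 0.
  by apply/funext => k; have [] := i_k k.
by move=> cS; apply/esym/(cvg_unique _ _ cS) => //; exact: cvg_cst.
Unshelve. all: by end_near.
Qed.

Let gauge_integral (X : Omega -> R) : has_law P X nu ->
  P.-integrable setT (EFin \o (@gauge R \o X)) /\
  \int[P]_w (@gauge R \o X) w = \int[nu]_x gauge x.
Proof.
move=> lX; apply: (has_law_integrable lX); first exact: measurable_gauge.
have i1 : nu.-integrable setT (EFin \o (fun x => 1 + `|x|)).
  have i1 := finite_measure_integrable_cst nu 1.
  by have := integrableD measurableT (i1 _ measurableT) (integrable_norm nu_moment).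
apply: le_integrable i1 => //.
- by apply/measurable_EFinP; exact: measurable_gauge.
- move=> x _ /=; rewrite lee_fin (ger0_norm (ltW (gauge_gt0 x))).
  by apply: le_trans (gauge_le x) _; exact: ler_norm.
Qed.

(** [D] is the height at [stopped B sigma] of the chord of [gauge] above its
graph. It is nonnegative and has mean 0, and it vanishes only at the ends. *)
Lemma embedding_reaches_boundary : {ae P, forall w,
  stopped B sigma w = lo w \/ stopped B sigma w = hi w}.
Proof.
have [i_s e_s] := slope_integral.
have [i1 e1] := gauge_integral tau_law.
have [i2 e2] := gauge_integral sigma_law.
pose D w := slope w * (stopped B sigma w - stopped B tau w) +
  ((@gauge R \o stopped B tau) w - (@gauge R \o stopped B sigma) w).
have i12 := integrableB measurableT i1 i2.
have iD : P.-integrable setT (EFin \o D) by have := integrableD measurableT i_s i12.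
have eD : \int[P]_w D w = 0.
  by rewrite RintegralD// RintegralB// e_s e1 e2; lra.
have key w : lo w <= stopped B sigma w <= hi w ->
    stopped B tau w = lo w \/ stopped B tau w = hi w ->
    (stopped B sigma w = lo w \/ stopped B sigma w = hi w) /\ D w = 0 \/ 0 < D w.
  move=> /andP[s1 s2] tv; rewrite /D/= /slope /inv_width.
  case: ifPn => [lohi|]; last first.
    rewrite -leNgt => hilo; left; rewrite mulr0 mul0r add0r.
    have E : stopped B tau w = stopped B sigma w by case: tv; lra.
    by rewrite E subrr; split=> //; left; lra.
  have d0 : 0 < hi w - lo w by rewrite subr_gt0.
  set y := stopped B sigma w in s1 s2 *.
  have E : (gauge (hi w) - gauge (lo w)) / (hi w - lo w) * (y - stopped B tau w) +
      (gauge (stopped B tau w) - gauge y) =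
      (gauge (lo w) * (hi w - y) + gauge (hi w) * (y - lo w) - gauge y * (hi w - lo w)) /
      (hi w - lo w).
    by case: tv => ->; field; rewrite gt_eqF.
  rewrite E.
  have [->|yl] := eqVneq y (lo w).
    by left; split; [left|rewrite subrr mulr0 addr0 subrr mul0r].
  have [->|yh] := eqVneq y (hi w).
    by left; split; [right|rewrite subrr mulr0 add0r subrr mul0r].
  right; rewrite divr_gt0// subr_gt0; apply: gauge_chord.
    by rewrite lt_neqAle eq_sym yl.
  by rewrite lt_neqAle yh.
have D0 : {ae P, forall w, 0 <= D w}.
  by apply: filterS2 sigma_value hit_time_value => w sv tv; have [[_ ->]|/ltW] := key w sv tv.
have := ae_eq0_of_Rintegral0 iD D0 eD.
apply: filterS3 sigma_value hit_time_value => w sv tv Dw.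
by have [[]|] := key w sv tv; rewrite // Dw ltxx.
Qed.

(** A time at which the process is at an end of the interval is not before
[tau]. *)
Lemma embedding_minimal : {ae P, forall w, sigma w = tau w}.
Proof.
apply: filterS3 sigma_le sigma_fin embedding_reaches_boundary => w sw fw sv.
apply/eqP; rewrite eq_le sw/=.
have [sigma0 _] := sigmaS.
have E : (fine (sigma w))%:E = sigma w by rewrite fineK// ge0_fin_numE.
rewrite -E; apply: first_time_le; split; first exact: fine_ge0.
move: sv; rewrite /stopped /both_gap /low_gap /high_gap le_max.
by move=> [] ->; rewrite subrr lexx ?orbT.
Qed.

End minimality.
End embedding.

(** * The coupling embedded by the maps *)

Section coupling_law.
Context d (Omega : measurableType d) (R : realType) (P : probability Omega R).
Variables (mu : probability R R) (F : R -> set (set Omega)) (B : R -> Omega -> R).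
Hypotheses (F_filtration : filtration F) (F_usual : usual_conditions P F).
Hypothesis B_brownian : brownian_motion P F mu B.
Variables (Td Tu : R -> R) (Pi : probability (R * R)%type R).
Hypothesis T_Pi : represents Td Tu mu Pi.

Let lo w := Td (B 0 w).
Let hi w := Tu (B 0 w).

Let mTd : measurable_fun setT Td.
Proof. by have [T_le T_fix _ _ T_left] := T_Pi; exact: measurable_Td. Qed.

Let mTu : measurable_fun setT Tu.
Proof. by have [_ _ _ Tu_mono _] := T_Pi; exact: measurable_Tu. Qed.

Let aB0 := B_adapted F_filtration B_brownian (lexx 0).

Lemma lower_adapted : adapted_at F 0 lo.
Proof. exact: measurableT_comp mTd aB0. Qed.

Lemma upper_adapted : adapted_at F 0 hi.
Proof. exact: measurableT_comp mTu aB0. Qed.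

Lemma start_between w : lo w <= B 0 w <= hi w.
Proof. by have [T_le _ _ _ _] := T_Pi; exact: T_le. Qed.

Let tau := hit_time B lo hi.

Lemma up_weightE w : up_weight Td Tu (B 0 w) = upper_weight B lo hi w.
Proof.
rewrite /up_weight /upper_weight /inv_width /lo /hi.
by case: ifPn => _; rewrite ?mul0r// mulrC.
Qed.

Let m_up : measurable_fun setT (up_weight Td Tu).
Proof.
have -> : up_weight Td Tu = (fun x => if Td x < Tu x then
    (x - Td x) * ((Tu x - Td x) `^ (-1)) else 0).
  apply/funext => x; rewrite /up_weight; case: ifPn => // lt_T.
  by rewrite powR_inv1// subr_ge0 ltW.
apply: measurable_fun_ifT; [exact: measurable_fun_ltr| |exact: measurable_cst].
apply: measurable_funM; first exact: measurable_funB.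
apply: (@measurableT_comp _ _ _ _ _ _ (@powR R ^~ (-1))); first exact: measurable_powR.
exact: measurable_funB.
Qed.

Lemma up_weight_itv x : 0 <= up_weight Td Tu x <= 1.
Proof.
have [T_le _ _ _ _] := T_Pi; have /andP[h1 h2] := T_le x.
rewrite /up_weight; case: ifPn => [lt_T|_]; last by rewrite lexx ler01.
by rewrite divr_ge0 ?subr_ge0 ?(ltW lt_T)//= ler_pdivrMr ?subr_gt0// mul1r lerD2r.
Qed.

(** On the event of leaving through the upper end, the indicator of [C] is that of
[(B 0, Tu (B 0))], otherwise that of [(B 0, Td (B 0))]. Hence its difference with
the kernel is, up to a factor known at time 0, the centred variable of optional
stopping. *)
Lemma coupling_law : has_law P (fun w => (B 0 w, stopped B tau w)) Pi.
Proof.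
have [T_le _ PiE _ _] := T_Pi.
have mval := measurable_hit_value F_filtration F_usual B_brownian lower_adapted
  upper_adapted start_between.
have mpair : measurable_fun setT (fun w => (B 0 w, stopped B tau w)).
  by apply: measurable_fun_pair => //; exact: (measurable_B F_filtration B_brownian).
split=> // C mC.
pose k x : R := up_weight Td Tu x * \1_C (x, Tu x) +
  (1 - up_weight Td Tu x) * \1_C (x, Td x).
have mCf (f : R -> R) : measurable_fun setT f ->
    measurable_fun setT (fun x => \1_C (x, f x) : R).
  move=> mf; apply: (@measurableT_comp _ _ _ _ _ _ (\1_C : R * R -> R)).
    exact: measurable_indic.
  exact: measurable_fun_pair.
have mk : measurable_fun setT k.
  apply: measurable_funD; apply: measurable_funM => //; try exact: mCf.
  exact: measurable_funB.
have ind01 (z : R * R) : 0 <= (\1_C z : R) <= 1.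
  by rewrite indicE ler0n lern1 leq_b1.
have k1 x : `|k x| <= 1.
  have /andP[u0 u1] := up_weight_itv x.
  have /andP[a0 a1] := ind01 (x, Tu x); have /andP[b0 b1] := ind01 (x, Td x).
  by rewrite /k ler_norml; apply/andP; split; nra.
have kE x : map_kernel Td Tu x (xsection C x) = (k x)%:E.
  by rewrite /map_kernel !diracE !mem_xsection -!EFinM -EFinD /k !indicE.
have ik : mu.-integrable setT (EFin \o k) by exact: bounded_integrable k1.
have PiC : Pi C = (\int[mu]_x k x)%:E.
  rewrite PiE// /Rintegral fineK; last exact: integrable_fin_num.
  by apply: eq_integral => x _; rewrite kE.
have [lB0 _ _ _ _] := B_brownian.
have [ikB ekB] := has_law_integrable lB0 mk ik.
pose E := (fun w => (B 0 w, stopped B tau w)) @^-1` C.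
have mE : measurable E by rewrite -[X in measurable X]setTI; exact: mpair.
have iE : P.-integrable setT (EFin \o (\1_E : Omega -> R)).
  apply: (@bounded_integrable _ _ _ _ _ 1); first exact: measurable_indic.
  by move=> w; rewrite indicE ger0_norm ?ler0n// lern1 leq_b1.
(* the indicator of C at the upper end minus the one at the lower end *)
pose g w : R := \1_C (B 0 w, hi w) - \1_C (B 0 w, lo w).
have ag : adapted_at F 0 g.
  by apply: measurable_funB; [exact: (measurableT_comp (mCf Tu mTu))|
    exact: (measurableT_comp (mCf Td mTd))].
have g1 w : `|g w| <= 1.
  have /andP[a0 a1] := ind01 (B 0 w, hi w); have /andP[b0 b1] := ind01 (B 0 w, lo w).
  by rewrite /g ler_norml; apply/andP; split; lra.
have [ig eg] := hit_time_integral F_filtration F_usual B_brownian lower_adapted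
  upper_adapted start_between ag g1.
have key : {ae P, forall w, \1_E w - (k \o B 0) w =
    g w * inv_width lo hi w * (stopped B tau w - B 0 w)}.
  apply: filterS (hit_time_value F_filtration F_usual B_brownian lower_adapted
    upper_adapted start_between) => w tv.
  rewrite -mulrA (hit_time_weight tv) /= /k up_weightE.
  have -> : \1_E w = \1_C (B 0 w, stopped B tau w) :> R by rewrite !indicE.
  rewrite /g /lo /hi -/tau.
  set u := upper_weight _ _ _ _; rewrite -/(lo w) -/(hi w).
  have [lohi|hilo] := ltP (lo w) (hi w); last first.
    have E1 : hi w = lo w by have := start_between w; lra.
    have -> : stopped B tau w = lo w by case: tv => ->.
    by rewrite E1/=; ring.
  have [->|ne] := eqVneq (stopped B tau w) (hi w); first by rewrite /=; ring.
  have -> : stopped B tau w = lo w by case: tv => // tv; move: ne; rewrite tv eqxx.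
  by rewrite /=; ring.
have -> : pushforward P (fun w => (B 0 w, stopped B tau w)) C = (\int[P]_w \1_E w)%:E.
  rewrite /Rintegral fineK; last exact: integrable_fin_num.
  by rewrite integral_indic// setIT.
rewrite PiC -ekB; congr EFin; apply/eqP; rewrite -subr_eq0 -RintegralB//; apply/eqP.
rewrite -[RHS]eg /Rintegral; congr fine.
apply: ae_eq_integral => //.
- by have /measurable_int := integrableB measurableT iE ikB.
- by have /measurable_int := ig.
- by apply: filterS key => w kw _; rewrite /= kw.
Qed.

End coupling_law.

Theorem lemma4p2 (R : realType) (mu nu : probability R R)
  (mu_moment : finite_first_moment mu) (nu_moment : finite_first_moment nu)
  (mu_nu : convex_order mu nu) (mu_atomless : atomless mu)
  (Pi : probability (R * R)%type R)
  (Pi_coupling : martingale_coupling mu nu Pi) (Pi_left : left_monotone Pi)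
  (Td Tu : R -> R) (T_Pi : represents Td Tu mu Pi)
  (d : measure_display) (Omega : measurableType d) (P : probability Omega R)
  (F : R -> set (set Omega)) (F_filtration : filtration F)
  (F_usual : usual_conditions P F)
  (B : R -> Omega -> R) (B_brownian : brownian_motion P F mu B) :
  let tau_P := tau_exit Td Tu B in
  let tau_R := tau_barrier (barrier Td Tu) B in
  [/\ stopping_time F tau_R, stopping_time F tau_P,
      {ae P, forall w, tau_R w = tau_P w},
      minimal_stopping_time P F B nu tau_R &
      has_law P (fun w => (B 0 w, stopped B tau_R w)) Pi].
Proof.
move=> tau_P tau_R.
have [T_le T_fix _ Tu_mono T_left] := T_Pi.
pose lo w := Td (B 0 w); pose hi w := Tu (B 0 w).
have alo : adapted_at F 0 lo := lower_adapted F_filtration B_brownian T_Pi.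
have ahi : adapted_at F 0 hi := upper_adapted F_filtration B_brownian T_Pi.
have B0 : forall w, lo w <= B 0 w <= hi w := start_between B T_Pi.
pose tau := hit_time B lo hi.
have tauS : stopping_time F tau := hit_time_stopping F_filtration F_usual B_brownian alo ahi.
have tau_fin : {ae P, forall w, (tau w < +oo)%E} := hit_time_fin B_brownian B0.
have tau_RE : {ae P, forall w, tau w = tau_R w}.
  apply: filterS (B_continuous B_brownian) => w cw.
  by rewrite /tau_R /tau_barrier -/(first_time _) (barrier_time_gap T_le Tu_mono T_left cw).
have tau_PE : tau_P = exit_time B lo hi.
  apply/funext => w.
  by rewrite /tau_P /tau_exit -/(first_time _) (exit_time_gap T_le (B ^~ w)).
have tau_R0 w : (0 <= tau_R w)%E.
  by apply: first_time_ge => t [t0 _]; rewrite lee_fin.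
have tau_RS : stopping_time F tau_R.
  exact: (stopping_time_ae F_filtration F_usual tauS tau_R0 tau_RE).
have valE : {ae P, forall w, stopped B tau w = stopped B tau_R w}.
  by apply: filterS tau_RE => w E; rewrite /stopped E.
have mB0 : measurable_fun setT (B 0) := measurable_B F_filtration B_brownian (lexx 0).
have mval : measurable_fun setT (stopped B tau_R).
  apply: (measurable_ae (usual_complete F_filtration F_usual) valE).
  exact: (measurable_hit_value F_filtration F_usual B_brownian alo ahi B0).
have tau_pair : has_law P (fun w => (B 0 w, stopped B tau w)) Pi.
  exact: (coupling_law F_filtration F_usual B_brownian T_Pi).
have [_ [_ Pi_snd] _] := Pi_coupling.
have tau_law : has_law P (stopped B tau) nu.
  split=> [|V mV].
    exact: (measurable_hit_value F_filtration F_usual B_brownian alo ahi B0).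
  have mVV : measurable (snd @^-1` V : set (R * R)).
    by rewrite -[X in measurable X]setTI; exact: measurable_snd.
  by have [_ /(_ _ mVV)] := tau_pair; rewrite -(Pi_snd V mV).
split=> //.
- by rewrite tau_PE; exact: (exit_time_stopping F_filtration F_usual B_brownian alo ahi).
- have := hit_time_exit_time F_filtration F_usual B_brownian alo ahi B0.
  by apply: filterS2 tau_RE => w E1 E2; rewrite tau_PE -E1.
- split=> //.
    split; first by apply: filterS2 tau_fin tau_RE => w + <-.
    exact: (has_law_ae mval valE tau_law).
  move=> sigma sigmaS sigma_le [sigma_fin sigma_law].
  have sigma_le' : {ae P, forall w, (sigma w <= tau w)%E}.
    by apply: filterS2 sigma_le tau_RE => w + ->.
  have := embedding_minimal F_filtration F_usual B_brownian alo ahi B0 nu_moment tau_law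
    sigmaS sigma_le' sigma_fin sigma_law.
  by apply: filterS2 tau_RE => w <-.
- apply: has_law_ae tau_pair; first exact: measurable_fun_pair.
  by apply: filterS valE => w ->.
Qed.
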